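(* Let $n \ge 1$ and let $T$ be a bounded linear operator on $H^2(\mathbb{D}^n)$. Then $T$ is an asymptotic Toeplitz operator if and only if $T$ is a compact perturbation of a Toeplitz operator, that is, $T = S + K$ for some Toeplitz operator $S$ and some compact operator $K$ on $H^2(\mathbb{D}^n)$.
   Context: $\mathbb{D}^n$ is the open unit polydisc in $\mathbb{C}^n$ and $\mathbb{T}^n$ is its distinguished boundary (the $n$-torus), with normalized Lebesgue measure. $H^2(\mathbb{D}^n)$ is the Hardy space of holomorphic functions $f$ on $\mathbb{D}^n$ with $\|f\|^2 = \sup_{0 \le r < 1} \int_{\mathbb{T}^n} |f(re^{i\theta_1}, \ldots, re^{i\theta_n})|^2 \, d\boldsymbol{\theta} < \infty$. Via radial limits it is identified with the closed subspace of $L^2(\mathbb{T}^n)$ consisting of functions whose Fourier coefficients $a_{\boldsymbol{k}}$, $\boldsymbol{k} \in \mathbb{Z}^n$, vanish whenever some $k_j < 0$. $T_{z_i}$ is the operator on $H^2(\mathbb{D}^n)$ of multiplication by the coordinate function $z_i$. $P_{H^2(\mathbb{D}^n)}$ is the orthogonal projection of $L^2(\mathbb{T}^n)$ onto $H^2(\mathbb{D}^n)$. For $\varphi \in L^\infty(\mathbb{T}^n)$, $M_\varphi$ is the operator $g \mapsto \varphi g$ on $L^2(\mathbb{T}^n)$. A bounded operator $S$ on $H^2(\mathbb{D}^n)$ is a Toeplitz operator if $S = P_{H^2(\mathbb{D}^n)} M_\varphi|_{H^2(\mathbb{D}^n)}$ for some $\varphi \in L^\infty(\mathbb{T}^n)$.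 A bounded operator $T$ on $H^2(\mathbb{D}^n)$ is an asymptotic Toeplitz operator if there exists a bounded operator $A$ on $H^2(\mathbb{D}^n)$ such that, for all $1 \le i, j \le n$, $T_{z_i}^{*m} T T_{z_i}^{m} \to A$ and $T_{z_i}^{*m} (T - A) T_{z_j}^{m} \to 0$ in operator norm as $m \to \infty$. *)

(* Defs.v *)
From HB Require Import structures.
From mathcomp Require Import all_boot all_order all_algebra.
From mathcomp Require Import complex.
From mathcomp Require Import all_classical all_reals all_analysis.
From mathcomp Require Import measurable_realfun ess_sup_inf.

Set Implicit Arguments.
Unset Strict Implicit.
Unset Printing Implicit Defensive.

Import Order.TTheory GRing.Theory Num.Theory.
Import numFieldNormedType.Exports.
Import ComplexField.Normc.

Local Open Scope classical_set_scope.
Local Open Scope ring_scope.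
Local Open Scope complex_scope.
Local Open Scope quotient_scope.

Section ComplexLp.
Context d (T : measurableType d) (R : realType).
Variable mu : {measure set T -> \bar R}.
Implicit Types f g : T -> R[i].

Local Notation Re := complex.Re.
Local Notation Im := complex.Im.

Definition cmeasurable f :=
  measurable_fun setT (fun x => Re (f x)) /\
  measurable_fun setT (fun x => Im (f x)).

Definition cLfun (p : \bar R) : {pred T -> R[i]} :=
  fun f => `[< cmeasurable f /\ finite_norm mu p (fun x => normc (f x)) >].

Definition cintegral f : R[i] :=
  (\int[mu]_x Re (f x)) +i* (\int[mu]_x Im (f x)).

Lemma normcE_sqrt (z : R[i]) : normc z = Num.sqrt (Re z ^+ 2 + Im z ^+ 2).
Proof. by case: z. Qed.

Lemma normc_ge0 (z : R[i]) : 0 <= normc z.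
Proof. by rewrite normcE_sqrt sqrtr_ge0. Qed.

Lemma normr_normc (z : R[i]) : `|z| = (normc z)%:C.
Proof. by rewrite normc_def normcE_sqrt. Qed.

Lemma ler_Re_normc (z : R[i]) : `|Re z| <= normc z.
Proof. by rewrite -lecR -normr_normc normc_ge_Re. Qed.

Lemma ler_Im_normc (z : R[i]) : `|Im z| <= normc z.
Proof.
case: z => a b /=; rewrite -sqrtr_sqr ler_sqrt ?lerDr ?sqr_ge0//.
by rewrite addr_ge0 ?sqr_ge0.
Qed.

Lemma cmeasurable_normc f : cmeasurable f ->
  measurable_fun setT (fun x => normc (f x)).
Proof.
move=> [mr mi]; under eq_fun do rewrite normcE_sqrt.
apply: (@measurableT_comp _ _ _ _ _ _ (@Num.sqrt R)) => //.
  apply: continuous_measurable_fun; exact: sqrt_continuous.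
by apply: measurable_funD; apply: measurable_funX.
Qed.

Lemma cmeasurableD f g : cmeasurable f -> cmeasurable g ->
  cmeasurable (fun x => f x + g x).
Proof.
move=> [fr fi] [gr gi]; split.
  under eq_fun do rewrite raddfD.
  exact: measurable_funD.
under eq_fun do rewrite raddfD.
exact: measurable_funD.
Qed.

Lemma ReM (z w : R[i]) : Re (z * w) = Re z * Re w - Im z * Im w.
Proof. by case: z w => a b []. Qed.

Lemma ImM (z w : R[i]) : Im (z * w) = Re z * Im w + Im z * Re w.
Proof. by case: z w => a b []. Qed.

Lemma cmeasurableM f g : cmeasurable f -> cmeasurable g ->
  cmeasurable (fun x => f x * g x).
Proof.
move=> [fr fi] [gr gi].
split.
  under eq_fun do rewrite ReM.
  by apply: measurable_funB; apply: measurable_funM.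
under eq_fun do rewrite ImM.
by apply: measurable_funD; apply: measurable_funM.
Qed.

Lemma cmeasurable_cst (a : R[i]) : cmeasurable (fun=> a).
Proof. by split; exact: measurable_cst. Qed.

Lemma cmeasurable_conj f : cmeasurable f -> cmeasurable (fun x => conjc (f x)).
Proof.
move=> [fr fi]; split.
  by apply: eq_measurable_fun fr => x _; case: (f x).
have : measurable_fun setT (fun x => - Im (f x)) by exact: measurableT_comp.
by apply: eq_measurable_fun => x _; case: (f x).
Qed.

Lemma cLfunP p f : reflect
  (cmeasurable f /\ finite_norm mu p (fun x => normc (f x))) (f \in cLfun p).
Proof. by rewrite unfold_in; exact: asboolP. Qed.

Lemma cLfun_Lfun p f : f \in cLfun p -> (fun x => normc (f x)) \in Lfun mu p.
Proof.
move=> /cLfunP[mf ff]; rewrite inE; apply/andP; split.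
  by rewrite inE; exact: cmeasurable_normc.
by rewrite inE.
Qed.

Lemma le_Lnorm2 (f g : T -> R) :
  measurable_fun setT f -> measurable_fun setT g ->
  {ae mu, forall x, `|f x| <= `|g x|} ->
  ('N[mu]_2%:E[EFin \o f] <= 'N[mu]_2%:E[EFin \o g])%E.
Proof.
move=> mf mg fg; rewrite unlock.
have mp (h : T -> R) : measurable_fun setT h ->
    measurable_fun setT (fun x => (`|h x| `^ 2)%:E).
  move=> mh; apply/measurable_EFinP.
  by apply: (@measurableT_comp _ _ _ _ _ _ (@powR R ^~ 2)) => //;
    exact: measurableT_comp.
rewrite gt0_ler_poweR ?invr_ge0//.
- by rewrite in_itv/= leey integral_ge0// => x _; rewrite poweR_ge0.
- by rewrite in_itv/= leey integral_ge0// => x _; rewrite poweR_ge0.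
- apply: ae_ge0_le_integral => //=.
  + exact: mp.
  + exact: mp.
  + by apply: filterS fg => x fgx _; rewrite lee_fin ge0_ler_powR.
Qed.

Lemma Lnorm2Z (a : R) (f : T -> R) : f \in Lfun mu 2%:E ->
  ('N[mu]_2%:E[EFin \o (fun x => a * f x)%R] =
   `|a|%:E * 'N[mu]_2%:E[EFin \o f])%E.
Proof.
have h : (1 <= 2%:E :> \bar R)%E by rewrite lee_fin ler1n.
by move=> fL; have := LnormZ (Lfun_Sub h fL) a.
Qed.

Lemma cLfun2_ae_le f (g : T -> R) : cmeasurable f -> g \in Lfun mu 2%:E ->
  {ae mu, forall x, normc (f x) <= `|g x|} -> f \in cLfun 2%:E.
Proof.
move=> mf /andP[+ +]; move=> /set_mem mg /set_mem fg le_fg.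
apply/cLfunP; split => //.
rewrite /finite_norm (le_lt_trans _ fg)// le_Lnorm2//.
  exact: cmeasurable_normc.
by apply: filterS le_fg => x; rewrite [`|normc _|]ger0_norm ?normc_ge0.
Qed.

Lemma cLfun2_submod_closed : submod_closed (cLfun 2%:E).
Proof.
split.
  apply/cLfunP; split; first exact: cmeasurable_cst.
  rewrite /finite_norm (_ : _ \o _ = cst 0%E).
    by rewrite Lnorm0 ?ltry// eqe pnatr_eq0.
  by apply/funext => x; congr EFin; exact: normc0.
move=> a f g fL gL.
have mf : cmeasurable f by case/cLfunP: fL.
have mg : cmeasurable g by case/cLfunP: gL.
apply: (@cLfun2_ae_le _ (fun x => normc a * normc (f x) + normc (g x))).
- by apply: cmeasurableD => //; apply: cmeasurableM => //; exact: cmeasurable_cst.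
- have h : (1 <= 2%:E :> \bar R)%E by rewrite lee_fin ler1n.
  exact: (proj2 (Lfun_submod_closed mu h) (normc a) _ _
           (cLfun_Lfun fL) (cLfun_Lfun gL)).
- apply: nearW => x /=.
  rewrite [leRHS]ger0_norm ?addr_ge0 ?mulr_ge0 ?normc_ge0//.
  by rewrite (le_trans (le_normcD _ _))// normcM.
Qed.

Lemma cLfun2M f g : f \in cLfun +oo%E -> g \in cLfun 2%:E ->
  (fun x => f x * g x) \in cLfun 2%:E.
Proof.
move=> fL gL.
have mg : cmeasurable g by case/cLfunP: gL.
move: (fL) => /cLfunP[mf].
rewrite /finite_norm unlock => fy.
have [M fM] : exists M : R, {ae mu, forall x, normc (f x) <= M}.
  move: fy; case: ifPn => [mu0 /ess_supr_bounded[M fM]|].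
    exists M; apply: filterS fM => x /=.
    by rewrite ger0_norm// normc_ge0.
  rewrite -leNgt => mu0 _; exists 0.
  have mu00 : mu setT = 0 by apply/eqP; rewrite eq_le mu0 measure_ge0.
  exists setT; split => //.
apply: (@cLfun2_ae_le _ (fun x => M * normc (g x))).
- exact: cmeasurableM.
- have h : (1 <= 2%:E :> \bar R)%E by rewrite lee_fin ler1n.
  have [z lin] := Lfun_submod_closed mu h.
  by have := lin M _ _ (cLfun_Lfun gL) z; rewrite addr0.
- apply: filterS fM => x fM.
  have M0 : 0 <= M by rewrite (le_trans _ fM)// normc_ge0.
  by rewrite normrM (ger0_norm M0) ger0_norm ?normc_ge0// normcM
    ler_wpM2r// normc_ge0.
Qed.

HB.instance Definition _ :=
  GRing.isSubmodClosed.Build R[i] (T -> R[i]) (cLfun 2%:E) cLfun2_submod_closed.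

Record L2fun := MkL2fun { L2fun_val :> T -> R[i]; _ : L2fun_val \in cLfun 2%:E }.

HB.instance Definition _ := [isSub for L2fun_val].
HB.instance Definition _ := [Choice of L2fun by <:].
HB.instance Definition _ := [SubChoice_isSubLmodule of L2fun by <:].

Implicit Types u v : L2fun.

Lemma L2funP u : (u : T -> R[i]) \in cLfun 2%:E.
Proof. exact: valP u. Qed.

Lemma L2fun_cmeasurable u : cmeasurable u.
Proof. by case/cLfunP: (L2funP u). Qed.

Definition L2null : {pred L2fun} :=
  fun u => `[< {ae mu, forall x, u x = 0} >].

Lemma L2nullP u : reflect {ae mu, forall x, u x = 0} (u \in L2null).
Proof. by rewrite unfold_in; exact: asboolP. Qed.

Lemma L2null_zmod_closed : zmod_closed L2null.
Proof.
split; first by apply/L2nullP; exact: nearW.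
move=> u v /L2nullP u0 /L2nullP v0; apply/L2nullP.
by apply: filterS2 u0 v0 => x u0 v0; rewrite [LHS](_ : _ = u x - v x)// u0 v0 subr0.
Qed.

HB.instance Definition _ :=
  GRing.isZmodClosed.Build L2fun L2null L2null_zmod_closed.

(* Square-integrable functions modulo almost-everywhere equality *)
Definition L2 := Quotient.quot L2null.
HB.instance Definition _ := GRing.Zmodule.on L2.
HB.instance Definition _ := EqQuotient.on L2.

Definition L2class u : L2 := \pi_L2 u.

Lemma L2classP u v : L2class u = L2class v <-> {ae mu, forall x, u x = v x}.
Proof.
split=> [/eqP|uv].
  rewrite -Quotient.idealrBE => /L2nullP; apply: filterS => x.
  by rewrite [X in X = 0](_ : _ = u x - v x)// => /eqP; rewrite subr_eq0 => /eqP.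
apply/eqP; rewrite -Quotient.idealrBE; apply/L2nullP; apply: filterS uv => x uv.
by rewrite [LHS](_ : _ = u x - v x)// uv subrr.
Qed.

Lemma repr_L2class u : {ae mu, forall x, (repr (L2class u) : L2fun) x = u x}.
Proof. by apply/L2classP; rewrite /L2class reprK. Qed.

Lemma L2classD u v : L2class (u + v) = L2class u + L2class v.
Proof. exact: (Quotient.pi_add L2null u v). Qed.

Lemma L2class_repr (F : L2) : L2class (repr F) = F.
Proof. exact: reprK. Qed.

Implicit Types F G : L2.

Lemma L2class0 : L2class 0 = 0.
Proof. by rewrite /L2class piE. Qed.

Definition L2scale (a : R[i]) (F : L2) : L2 := L2class (a *: repr F).

Lemma L2scale_class a u : L2scale a (L2class u) = L2class (a *: u).
Proof.
apply/L2classP; apply: filterS (repr_L2class u) => x ux.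
by rewrite [LHS](_ : _ = a * (repr (L2class u) : L2fun) x)// ux.
Qed.

Lemma L2scaleA a b F : L2scale a (L2scale b F) = L2scale (a * b) F.
Proof. by rewrite -[F]L2class_repr !L2scale_class scalerA. Qed.

Lemma L2scale1 : left_id 1 L2scale.
Proof. by move=> F; rewrite -[F]L2class_repr L2scale_class scale1r. Qed.

Lemma L2scaleDr : right_distributive L2scale +%R.
Proof.
move=> a F G; rewrite -[F]L2class_repr -[G]L2class_repr -L2classD.
by rewrite !L2scale_class scalerDr L2classD.
Qed.

Lemma L2scaleDl F : {morph L2scale^~ F : a b / a + b}.
Proof.
by move=> a b; rewrite -[F]L2class_repr !L2scale_class scalerDl L2classD.
Qed.

HB.instance Definition _ := GRing.Zmodule_isLmodule.Build R[i] L2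
  L2scaleA L2scale1 L2scaleDr L2scaleDl.

Definition L2norm (F : L2) : R :=
  fine 'N[mu]_2%:E[EFin \o (fun x => normc ((repr F : L2fun) x))].

Definition L2dot (F G : L2) : R[i] :=
  cintegral (fun x => (repr F : L2fun) x * conjc ((repr G : L2fun) x)).

Lemma L2norm_class u :
  ((L2norm (L2class u))%:E = 'N[mu]_2%:E[EFin \o (fun x => normc (u x))])%E.
Proof.
have mr (w : L2fun) : measurable_fun setT (fun x => normc (w x)).
  exact/cmeasurable_normc/L2fun_cmeasurable.
have le (w w' : L2fun) : {ae mu, forall x, w x = w' x} ->
  ('N[mu]_2%:E[EFin \o (fun x => normc (w x))] <=
   'N[mu]_2%:E[EFin \o (fun x => normc (w' x))])%E.
  by move=> ww'; apply: le_Lnorm2 => //; apply: filterS ww' => x ->.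
have -> : ('N[mu]_2%:E[EFin \o (fun x => normc (u x))] =
    'N[mu]_2%:E[EFin \o (fun x => normc ((repr (L2class u) : L2fun) x))])%E.
  apply/eqP; rewrite eq_le !le//; first exact: repr_L2class.
  by apply: filterS (repr_L2class u) => x ->.
rewrite fineK// ge0_fin_numE ?Lnorm_ge0//.
by case/cLfunP: (L2funP (repr (L2class u))).
Qed.

Lemma ler_L2normD F G : L2norm (F + G) <= L2norm F + L2norm G.
Proof.
rewrite -[F]L2class_repr -[G]L2class_repr -L2classD.
move: (repr F) (repr G) => {F G} u v.
rewrite -lee_fin EFinD !L2norm_class.
have mr (w : L2fun) : measurable_fun setT (fun x => normc (w x)).
  exact/cmeasurable_normc/L2fun_cmeasurable.
have h : (1 <= 2 :> R) by rewrite ler1n.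
apply: le_trans (minkowski_EFin mu (mr u) (mr v) h).
apply: le_Lnorm2 => //; first exact: measurable_funD.
apply: nearW => x /=; rewrite !ger0_norm ?addr_ge0 ?normc_ge0//.
exact: le_normcD.
Qed.

Lemma L2normZ (a : R[i]) F : L2norm (a *: F) = normc a * L2norm F.
Proof.
rewrite -[F]L2class_repr; move: (repr F) => {F} u.
apply: EFin_inj; rewrite [a *: _]L2scale_class EFinM !L2norm_class.
rewrite -[normc a]ger0_norm ?normc_ge0// -Lnorm2Z; last exact/cLfun_Lfun/L2funP.
by congr Lnorm; apply/funext => x; congr EFin; exact: normcM.
Qed.

Lemma L2norm_eq0 F : L2norm F = 0 -> F = 0.
Proof.
rewrite -[F]L2class_repr; move: (repr F) => {F} u.
move=> n0; have := L2norm_class u; rewrite n0 => /esym u0 {n0}.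
rewrite -L2class0; apply/L2classP.
have mr : measurable_fun setT (fun x => normc (u x)).
  exact/cmeasurable_normc/L2fun_cmeasurable.
have : (EFin \o (fun x => normc (u x)) = \0 %[ae mu])%E.
  apply: (Lnorm_eq0_eq0 _ _ u0); last by rewrite lte_fin.
  exact/measurable_EFinP.
by apply: filterS => x /(_ I) [] /eq0_normc.
Qed.

(* A normed module over R[i] has an R[i]-valued norm. *)
Definition L2normC (F : L2) : R[i] := (L2norm F)%:C.

Lemma ler_L2normCD F G : L2normC (F + G) <= L2normC F + L2normC G.
Proof. by rewrite /L2normC -rmorphD lecR ler_L2normD. Qed.

Lemma L2normCZ (a : R[i]) F : L2normC (a *: F) = `|a| * L2normC F.
Proof. by rewrite /L2normC L2normZ normr_normc rmorphM. Qed.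

Lemma L2normC_eq0 F : L2normC F = 0 -> F = 0.
Proof. by case => /L2norm_eq0. Qed.

HB.instance Definition _ :=
  Lmodule_isNormed.Build R[i] L2 ler_L2normCD L2normCZ L2normC_eq0.

Definition cintegrable (f : T -> R[i]) :=
  mu.-integrable setT (fun x => (Re (f x))%:E) /\
  mu.-integrable setT (fun x => (Im (f x))%:E).

Lemma cintegralD f g : cintegrable f -> cintegrable g ->
  cintegral (fun x => f x + g x) = cintegral f + cintegral g.
Proof.
move=> [fr fi] [gr gi]; rewrite /cintegral.
under eq_Rintegral do rewrite raddfD.
rewrite RintegralD//; congr (_ +i* _).
rewrite (@eq_Rintegral _ _ _ mu _ (fun x => Im (f x) + Im (g x))); last first.
  by move=> x _; rewrite raddfD.
by rewrite RintegralD.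
Qed.

Lemma cintegralZ a f : cintegrable f ->
  cintegral (fun x => a * f x) = a * cintegral f.
Proof.
move=> [fr fi]; rewrite /cintegral.
have iZ (b : R) (h : T -> R) : mu.-integrable setT (fun x => (h x)%:E) ->
    mu.-integrable setT (fun x => (b * h x)%:E).
  move=> ih; under eq_fun do rewrite EFinM; exact: integrableZl.
have -> : \int[mu]_x Re (a * f x) =
    Re a * \int[mu]_x Re (f x) - Im a * \int[mu]_x Im (f x).
  rewrite -!RintegralZl// -RintegralB//; [|exact: iZ|exact: iZ].
  by apply: eq_Rintegral => x _; rewrite ReM.
have -> : \int[mu]_x Im (a * f x) =
    Re a * \int[mu]_x Im (f x) + Im a * \int[mu]_x Re (f x).
  rewrite -!RintegralZl// -RintegralD//; [|exact: iZ|exact: iZ].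
  by apply: eq_Rintegral => x _; rewrite ImM.
by case: (a).
Qed.

Lemma ae_eq_cintegral f g : cmeasurable f -> cmeasurable g ->
  {ae mu, forall x, f x = g x} -> cintegral f = cintegral g.
Proof.
move=> [fr fi] [gr gi] fg; rewrite /cintegral /Rintegral.
congr (fine _ +i* fine _); apply: ae_eq_integral => //.
- exact/measurable_EFinP.
- exact/measurable_EFinP.
- by apply: filterS fg => x -> _.
- exact/measurable_EFinP.
- exact/measurable_EFinP.
- by apply: filterS fg => x -> _.
Qed.

Lemma cmeasurable_dot u v : cmeasurable (fun x => u x * conjc (v x)).
Proof.
apply: cmeasurableM; first exact: L2fun_cmeasurable.
exact/cmeasurable_conj/L2fun_cmeasurable.
Qed.

Lemma cintegrable_dot u v : cintegrable (fun x => u x * conjc (v x)).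
Proof.
have [mr mi] := cmeasurable_dot u v.
have : (fun x => normc (u x) * normc (v x)) \in Lfun mu 1.
  by apply: Lfun2_mul_Lfun1; exact/cLfun_Lfun/L2funP.
move=> /Lfun1_integrable iuv.
have nM x : normc (u x * conjc (v x)) = normc (u x) * normc (v x).
  rewrite normcM; congr (_ * _); apply: complexI.
  by rewrite -!normr_normc normcJ.
have n0 x : 0 <= normc (u x) * normc (v x) by rewrite mulr_ge0 ?normc_ge0.
split; apply: le_integrable iuv => //.
- exact/measurable_EFinP.
- by move=> x _; rewrite /= lee_fin (ger0_norm (n0 x)) -nM ler_Re_normc.
- exact/measurable_EFinP.
- by move=> x _; rewrite /= lee_fin (ger0_norm (n0 x)) -nM ler_Im_normc.
Qed.

Lemma L2dot_class u v :
  L2dot (L2class u) (L2class v) = cintegral (fun x => u x * conjc (v x)).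
Proof.
apply: ae_eq_cintegral; [exact: cmeasurable_dot|exact: cmeasurable_dot|].
by apply: filterS2 (repr_L2class u) (repr_L2class v) => x -> ->.
Qed.

Lemma L2dotDl F G H : L2dot (F + G) H = L2dot F H + L2dot G H.
Proof.
rewrite -[F]L2class_repr -[G]L2class_repr -[H]L2class_repr -L2classD.
rewrite !L2dot_class -cintegralD; [|exact: cintegrable_dot..].
by congr cintegral; apply/funext => x; exact: mulrDl.
Qed.

Lemma L2dotZl a F H : L2dot (a *: F) H = a * L2dot F H.
Proof.
rewrite -[F]L2class_repr -[H]L2class_repr [a *: _]L2scale_class.
rewrite !L2dot_class -cintegralZ; last exact: cintegrable_dot.
by congr cintegral; apply/funext => x; rewrite mulrA.
Qed.

Lemma L2dot0l H : L2dot 0 H = 0.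
Proof. by rewrite -(scale0r (0 : L2)) L2dotZl mul0r. Qed.

Record Linfty := MkLinfty { Linfty_val :> T -> R[i];
  LinftyP : Linfty_val \in cLfun +oo%E }.

Definition L2mulfun (phi : Linfty) u : L2fun :=
  MkL2fun (cLfun2M (LinftyP phi) (L2funP u)).

Definition L2mul (phi : Linfty) (F : L2) : L2 := L2class (L2mulfun phi (repr F)).

Lemma L2mul_class phi u : L2mul phi (L2class u) = L2class (L2mulfun phi u).
Proof. by apply/L2classP; apply: filterS (repr_L2class u) => x /= ->. Qed.

End ComplexLp.

Arguments L2dot {d T R mu} F G.
Arguments L2mul {d T R mu} phi F.
Arguments L2norm {d T R mu} F.

Section Torus.
Variable R : realType.
Local Notation RT := (measurableTypeR R).

Lemma circle_lt : 0 < 2 * pi :> R.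
Proof. by rewrite mulr_gt0 ?pi_gt0. Qed.

Section cons_mfun.
Variable n : nat.

Definition tuple_cons (x : RT * n.-tuple RT) : n.+1.-tuple RT :=
  [tuple of x.1 :: x.2].

Lemma measurable_tuple_cons : measurable_fun setT tuple_cons.
Proof. exact: measurable_cons. Qed.

HB.instance Definition _ :=
  isMeasurableFun.Build _ _ _ _ tuple_cons measurable_tuple_cons.
End cons_mfun.

(* The torus T^n is parametrized by angles: the point with angles x is
   (e^{i x_1}, ..., e^{i x_n}), and normalized Lebesgue measure on T^n is the
   n-fold product of the uniform probability on [0, 2 pi]. Classes of functions
   modulo this measure on n.-tuple R are classes of functions on T^n. *)
Fixpoint torus_measure (n : nat) : probability (n.-tuple RT) R :=
  match n with
  | 0 => \d_ ([tuple] : 0.-tuple RT)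
  | n.+1 => distribution (uniform_prob circle_lt \x torus_measure n)%E
              (@tuple_cons n)
  end.

Definition expi (t : R) : R[i] := cos t +i* sin t.

Lemma normc_expi t : normc (expi t) = 1.
Proof. by rewrite /= cos2Dsin2 sqrtr1. Qed.

Lemma expiD s t : expi (s + t) = expi s * expi t.
Proof.
apply/eqP; rewrite eq_complex ReM ImM /= cosD sinD eqxx /=.
by rewrite addrC.
Qed.

Lemma conj_expi t : conjc (expi t) = expi (- t).
Proof. by rewrite /expi /= cosN sinN. Qed.

Lemma cmeasurable_expi d (T : measurableType d) (h : T -> R) :
  measurable_fun setT h -> cmeasurable (fun x => expi (h x)).
Proof.
move=> mh; split => /=.
  apply: (@measurableT_comp _ _ _ _ _ _ (@cos R)) => //.
  by apply: continuous_measurable_fun; exact: continuous_cos.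
apply: (@measurableT_comp _ _ _ _ _ _ (@sin R)) => //.
by apply: continuous_measurable_fun; exact: continuous_sin.
Qed.

Lemma expi_cLfun d (T : measurableType d) (P : probability T R) (h : T -> R) p :
  (0 < p)%E -> measurable_fun setT h -> (fun x => expi (h x)) \in cLfun P p.
Proof.
move=> p0 mh; apply/cLfunP; split; first exact: cmeasurable_expi.
rewrite /finite_norm (_ : _ \o _ = cst 1%E); last first.
  by apply/funext => x; congr EFin; exact: normc_expi.
have PT : (P : {measure set T -> \bar R}) setT = 1%E by exact: probability_setT.
case: p p0 => // [r r0|_]; first by rewrite Lnorm_cst1 PT poweR1r ltry.
rewrite unlock; case: ifPn => [P0|_]; last exact: ltry.
rewrite (_ : _ \o _ = cst 1%E); first by rewrite ess_sup_cst ?ltry.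
by apply/funext => x /=; rewrite normr1.
Qed.

Variable n : nat.
Local Notation mu := (torus_measure n).

Local Notation L2torus := (L2 mu).

Definition phase (k : 'I_n -> int) (x : n.-tuple RT) : R :=
  \sum_j (k j)%:~R * tnth x j.

Lemma measurable_phase k : measurable_fun setT (phase k).
Proof.
apply: measurable_sum => j; apply: measurable_funM => //.
exact: measurable_tnth.
Qed.

Definition character_fun k : L2fun mu :=
  MkL2fun (expi_cLfun mu (lte0n 2) (measurable_phase k)).

Definition fourier_coef (f : L2torus) (k : 'I_n -> int) : R[i] :=
  L2dot f (L2class (character_fun k)).

(* H^2(D^n), identified through radial limits with the closed subspace of
   L^2(T^n) of functions whose Fourier coefficients a_k vanish as soon as some
   k_j < 0. *)
Definition hardy : {pred L2torus} := fun f =>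
  `[< forall k : 'I_n -> int, (exists j, k j < 0) -> fourier_coef f k = 0 >].

Lemma hardyP f : reflect
  (forall k : 'I_n -> int, (exists j, k j < 0) -> fourier_coef f k = 0)
  (f \in hardy).
Proof. by rewrite unfold_in; exact: asboolP. Qed.

Lemma hardy_submod_closed : submod_closed hardy.
Proof.
split; first by apply/hardyP => k _; exact: L2dot0l.
move=> a f g /hardyP f0 /hardyP g0; apply/hardyP => k k0.
by rewrite /fourier_coef L2dotDl L2dotZl [L2dot f _]f0// [L2dot g _]g0// mulr0 addr0.
Qed.

HB.instance Definition _ :=
  GRing.isSubmodClosed.Build R[i] L2torus hardy hardy_submod_closed.

Record H2 := MkH2 { H2_val :> L2torus; _ : H2_val \in hardy }.

HB.instance Definition _ := [isSub for H2_val].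
HB.instance Definition _ := [Choice of H2 by <:].
HB.instance Definition _ := [SubChoice_isSubLmodule of H2 by <:].

Implicit Types (f g h : H2) (S : H2 -> H2).

Lemma H2P f : (f : L2torus) \in hardy.
Proof. exact: valP f. Qed.

Definition H2norm f : R[i] := `|H2_val f|.

Lemma ler_H2normD f g : H2norm (f + g) <= H2norm f + H2norm g.
Proof. exact: ler_normD. Qed.

Lemma H2normZ (a : R[i]) f : H2norm (a *: f) = `|a| * H2norm f.
Proof. exact: normrZ. Qed.

Lemma H2norm_eq0 f : H2norm f = 0 -> f = 0.
Proof. by move=> f0; apply: val_inj; exact: normr0_eq0. Qed.

HB.instance Definition _ :=
  Lmodule_isNormed.Build R[i] H2 ler_H2normD H2normZ H2norm_eq0.

(* The coordinate function z_i on T^n *)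
Definition coord (i : 'I_n) : Linfty mu :=
  MkLinfty (expi_cLfun mu (ltry 0) (@measurable_tnth _ RT n i)).

Lemma coord_hardy i f : L2mul (coord i) f \in hardy.
Proof.
apply/hardyP => k [j kj].
pose k' := fun l => k l - (l == i)%:R.
have <- : fourier_coef f k' = fourier_coef (L2mul (coord i) f) k.
  rewrite /fourier_coef -[H2_val f]L2class_repr L2mul_class !L2dot_class.
  congr cintegral; apply/funext => x.
  have kE : phase k' x = phase k x - tnth x i.
    rewrite /phase (bigD1 i)//= [in RHS](bigD1 i)//= /k' eqxx.
    rewrite rmorphB mulrBl mul1r addrAC; congr (_ + _ - _).
    by apply: eq_bigr => l /negPf ->; rewrite subr0.
  rewrite [RHS](_ : _ = expi (tnth x i) * (repr (H2_val f) : L2fun mu) x *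
    conjc (expi (phase k x)))// [LHS](_ : _ =
    (repr (H2_val f) : L2fun mu) x * conjc (expi (phase k' x)))//.
  by rewrite kE !conj_expi opprB expiD mulrCA mulrA.
apply: (hardyP _ (H2P f)); exists j; rewrite /k'.
by rewrite (le_lt_trans _ kj)// gerBl ler0n.
Qed.

Definition Tz (i : 'I_n) (f : H2) : H2 := MkH2 (coord_hardy i f).

(* The orthogonal projection of u onto the closed subspace H2 is the unique h
   in H2 with u - h orthogonal to H2; the default value of xget is not used. *)
Definition hardy_proj (u : L2torus) : H2 :=
  xget 0 [set h : H2 | forall g : H2, L2dot (u - H2_val h) g = 0].

(* S^* f is the unique h with <S g, f> = <g, h> for all g (Riesz); the default
   value of xget is not used when S is linear and bounded. *)
Definition adjoint S (f : H2) : H2 :=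
  xget 0 [set h : H2 | forall g : H2, L2dot (S g) f = L2dot g h].

Definition bounded_op S := exists M : R, forall f, `|S f| <= M%:C * `|f|.

Definition opnorm S : \bar R :=
  ereal_sup [set (L2norm (S f))%:E | f in [set f | `|f| <= 1]].

Definition compact_op S := compact (closure (S @` [set f | `|f| <= 1])).

Definition toeplitz (S : {linear H2 -> H2}) := bounded_op S /\
  exists phi : Linfty mu, forall f, S f = hardy_proj (L2mul phi f).

Definition asymptotic_toeplitz (T : {linear H2 -> H2}) := bounded_op T /\
  exists2 A : {linear H2 -> H2}, bounded_op A & forall i j : 'I_n,
    (fun m => opnorm (fun f =>
       iter m (adjoint (Tz i)) (T (iter m (Tz i) f)) - A f)) @ \oo --> 0%E /\
    (fun m => opnorm (fun f =>
       iter m (adjoint (Tz i))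
         (T (iter m (Tz j) f) - A (iter m (Tz j) f)))) @ \oo --> 0%E.

End Torus.

(* Main.v *)
Require Import Defs.
From HB Require Import structures.
From mathcomp Require Import all_boot all_order all_algebra.
From mathcomp Require Import complex.
From mathcomp Require Import all_classical all_reals all_analysis.
From mathcomp Require Import measurable_realfun ess_sup_inf.
From mathcomp Require Import ring lra zify.

Set Implicit Arguments.
Unset Strict Implicit.
Unset Printing Implicit Defensive.

Import Order.TTheory GRing.Theory Num.Theory.
Import numFieldNormedType.Exports.
Import ComplexField.Normc.

Local Open Scope classical_set_scope.
Local Open Scope ring_scope.
Local Open Scope complex_scope.

(** Conjugating an operator by high powers of the coordinate shifts forgets what
    it does on low frequencies, and only that: the limit is a Toeplitz operator
    and what is lost is compact. Below, [T_i] is the shift [Tz i], and [T_i'] its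
    adjoint.

    Let [T] be asymptotic Toeplitz with limit [A]. Conjugating the sequence
    [T_i'^m T T_i^m] by [T_i] only renumbers it, so [T_i' A T_i = A] for all [i]
    ([asymptotic_limit_shift]). An operator with this invariance is Toeplitz
    ([brown_halmos]). Indeed its matrix entry at two monomials depends only on the
    difference of the exponents ([symbol_coefE]). The entries with differences in a
    finite set are Fourier coefficients of [A (z^m)] divided by [z^m], for a high
    monomial [z^m], so they are square summable and are the Fourier coefficients of
    some [Phi] in L2 ([symbol_exists]). The same translation into the Hardy space
    shows that multiplication by [Phi] is bounded by the norm of [A] on
    trigonometric polynomials; testing it on the indicator of the set where
    [|Phi|] exceeds this norm shows that [Phi] is essentially bounded
    ([symbol_ae_bounded]).

    The remainder [K = T - A] is compact. An element of the Hardy space without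
    frequencies in the box [[0, m)^n] is a sum of [n] terms [z_i^m f_i] with
    [|f_i| <= |f|] ([off_box_decomposition]), so on such elements the form of [K]
    is at most [n^2] times the largest norm of [T_i'^m K T_j^m], which is small for
    large [m]. The rest of [K] has finite rank, because a box contains finitely
    many frequencies ([compact_op_off_box]).

    Conversely, let [T = S + K] with [S] Toeplitz and [K] compact. Then
    [T_i'^m S T_i^m = S] ([toeplitz_Tz_adj]), while the contractions [T_i'^m] tend
    to [0] pointwise, hence uniformly on the relatively compact image of the unit
    ball under [K] ([compact_Tz_adj_cvg0]).

    Two facts of Fourier analysis carry these arguments: L2 is complete
    ([L2_complete]), and the characters of the torus are total in it
    ([chi_total]). For the second one, the half-spaces [x_j < a] have indicators
    that are bounded limits of trigonometric polynomials ([trig_limit_lt]), so the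
    integral of a function with vanishing Fourier coefficients is zero over their
    finite intersections, which generate all measurable sets. *)

(** * Complex numbers and the inner product of L2 *)
Section ComplexNumbers.
Context {R : realType}.
Implicit Types z w : R[i].
Local Notation Re := complex.Re.
Local Notation Im := complex.Im.

Lemma normc_sqr z : (normc z ^+ 2)%:C = z * conjc z.
Proof. by rewrite -sqr_normc normr_normc rmorphXn. Qed.

Lemma normc_sqrE z : normc z ^+ 2 = Re z ^+ 2 + Im z ^+ 2.
Proof. by rewrite normcE_sqrt sqr_sqrtr// addr_ge0 ?sqr_ge0. Qed.

Lemma normc_conj z : normc (conjc z) = normc z.
Proof. by case: z => a b /=; rewrite sqrrN. Qed.

Lemma normc_real (a : R) : normc a%:C = `|a|.
Proof. by rewrite /= expr0n/= addr0 sqrtr_sqr. Qed.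

Lemma normc_eq0 z : (normc z == 0) = (z == 0).
Proof. by apply/eqP/eqP => [/eq0_normc//|->]; exact: normc0. Qed.

Lemma conjcM z w : conjc (z * w) = conjc z * conjc w.
Proof. exact: rmorphM. Qed.

End ComplexNumbers.

Section InnerProduct.
Context d (T : measurableType d) (R : realType).
Variable mu : {measure set T -> \bar R}.
Local Notation Re := complex.Re.
Local Notation Im := complex.Im.
Implicit Types (F G H : L2 mu) (u v : L2fun mu).

Lemma L2classZ a u : L2class (a *: u) = a *: L2class u.
Proof. exact/esym/L2scale_class. Qed.

Lemma L2classB u v : L2class (u - v) = L2class u - L2class v.
Proof. by rewrite L2classD -scaleN1r L2classZ scaleN1r. Qed.

Lemma L2norm_ge0 F : 0 <= L2norm F.
Proof. by rewrite /L2norm fine_ge0// Lnorm_ge0. Qed.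

Lemma L2norm_sqr_class u :
  ((L2norm (L2class u) ^+ 2)%:E = \int[mu]_x (normc (u x) ^+ 2)%:E)%E.
Proof.
have := powR_Lnorm mu (EFin \o (fun x => normc (u x))) (r := 2).
rewrite pnatr_eq0 => /(_ isT).
rewrite -L2norm_class poweR_EFin powR_mulrn ?L2norm_ge0// => ->.
apply: eq_integral => x _ /=.
by rewrite ger0_norm ?normc_ge0// powR_mulrn ?normc_ge0.
Qed.

Lemma cLfun2_sqr f : cmeasurable f ->
  (\int[mu]_x (normc (f x) ^+ 2)%:E < +oo)%E -> f \in cLfun mu 2%:E.
Proof.
move=> mf fy; apply/cLfunP; split => //.
rewrite /finite_norm unlock.
rewrite (_ : (\int[mu]_x _ = \int[mu]_x (normc (f x) ^+ 2)%:E)%E).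
  by rewrite poweR_lty.
apply: eq_integral => x _ /=.
by rewrite ger0_norm ?normc_ge0// powR_mulrn ?normc_ge0.
Qed.

Lemma cintegral_conj f : cintegrable mu f ->
  cintegral mu (fun x => conjc (f x)) = conjc (cintegral mu f).
Proof.
move=> [fr fi]; rewrite /cintegral /=.
have -> : \int[mu]_x Re (conjc (f x)) = \int[mu]_x Re (f x).
  by apply: eq_Rintegral => x _; case: (f x).
congr (_ +i* _).
rewrite -[RHS]mulN1r -RintegralZl//.
by apply: eq_Rintegral => x _; case: (f x) => a b /=; rewrite mulN1r.
Qed.

Lemma L2dotC F G : L2dot G F = conjc (L2dot F G).
Proof.
rewrite -[F]L2class_repr -[G]L2class_repr !L2dot_class -cintegral_conj.
  by congr cintegral; apply/funext => x; rewrite rmorphM /= conjcK mulrC.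
exact: cintegrable_dot.
Qed.

Lemma L2dotDr F G H : L2dot F (G + H) = L2dot F G + L2dot F H.
Proof. by rewrite L2dotC L2dotDl rmorphD (L2dotC G F) (L2dotC H F). Qed.

Lemma L2dotZr a F G : L2dot F (a *: G) = conjc a * L2dot F G.
Proof. by rewrite L2dotC L2dotZl rmorphM (L2dotC G F). Qed.

Lemma L2dot0r F : L2dot F 0 = 0.
Proof. by rewrite L2dotC L2dot0l conjc0. Qed.

Lemma L2dotNl F G : L2dot (- F) G = - L2dot F G.
Proof. by rewrite -scaleN1r L2dotZl mulN1r. Qed.

Lemma L2dotBl F G H : L2dot (F - G) H = L2dot F H - L2dot G H.
Proof. by rewrite L2dotDl L2dotNl. Qed.

Lemma L2dot_suml (I : Type) (r : seq I) (P : pred I) (f : I -> L2 mu) G :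
  L2dot (\sum_(i <- r | P i) f i) G = \sum_(i <- r | P i) L2dot (f i) G.
Proof.
by apply: (big_morph (fun F => L2dot F G)) => [x y|]; rewrite ?L2dotDl ?L2dot0l.
Qed.

Lemma L2dot_sumr (I : Type) (r : seq I) (P : pred I) F (g : I -> L2 mu) :
  L2dot F (\sum_(i <- r | P i) g i) = \sum_(i <- r | P i) L2dot F (g i).
Proof.
by apply: (big_morph (L2dot F)) => [x y|]; rewrite ?L2dotDr ?L2dot0r.
Qed.

Lemma L2dotFF F : L2dot F F = (L2norm F ^+ 2)%:C.
Proof.
rewrite -[F]L2class_repr; move: (repr F) => {F} u.
rewrite L2dot_class /cintegral.
have E x : u x * conjc (u x) = (normc (u x) ^+ 2)%:C by rewrite normc_sqr.
have -> : \int[mu]_x Im (u x * conjc (u x)) = 0.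
  under eq_Rintegral do rewrite E /=.
  by rewrite /Rintegral integral0.
congr (_ +i* _); rewrite /Rintegral.
under eq_integral do rewrite E /=.
by rewrite -L2norm_sqr_class.
Qed.

Lemma L2norm0 : L2norm (0 : L2 mu) = 0.
Proof.
have := L2dotFF 0; rewrite L2dot0l => /complexI/esym/eqP.
by rewrite sqrf_eq0 => /eqP.
Qed.

Lemma L2normN F : L2norm (- F) = L2norm F.
Proof. by rewrite -scaleN1r L2normZ normcN normc1 mul1r. Qed.

Lemma L2norm_distC F G : L2norm (F - G) = L2norm (G - F).
Proof. by rewrite -L2normN opprB. Qed.

Lemma ler_L2normB F G : L2norm (F - G) <= L2norm F + L2norm G.
Proof. by rewrite (le_trans (ler_L2normD _ _))// L2normN. Qed.

Lemma L2norm_triangle F G H :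
  L2norm (F - H) <= L2norm (F - G) + L2norm (G - H).
Proof. by rewrite (le_trans _ (ler_L2normD _ _))// addrA subrK. Qed.

Lemma L2norm_sum (I : Type) (r : seq I) (P : pred I) (f : I -> L2 mu) :
  L2norm (\sum_(i <- r | P i) f i) <= \sum_(i <- r | P i) L2norm (f i).
Proof.
elim/big_ind2 : _ => [|x a y b xa yb|//]; first by rewrite L2norm0.
by rewrite (le_trans (ler_L2normD _ _))// lerD.
Qed.

Lemma L2norm_sqrD F G : L2norm (F + G) ^+ 2 =
  L2norm F ^+ 2 + L2norm G ^+ 2 + 2 * Re (L2dot F G).
Proof.
apply: complexI; rewrite -L2dotFF L2dotDl !L2dotDr (L2dotC F G) !L2dotFF.
case: (L2dot F G) => a b; rewrite !rmorphD /=.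
by apply/eqP; rewrite eq_complex /=; apply/andP; split; apply/eqP; ring.
Qed.

Lemma L2pythagoras F G : L2dot F G = 0 ->
  L2norm (F + G) ^+ 2 = L2norm F ^+ 2 + L2norm G ^+ 2.
Proof. by move=> FG; rewrite L2norm_sqrD FG /= mulr0 addr0. Qed.

Lemma L2cauchy_schwarz F G : normc (L2dot F G) <= L2norm F * L2norm G.
Proof.
have [G0|G0] := eqVneq (L2norm G) 0.
  by rewrite (L2norm_eq0 G0) L2dot0r normc0 L2norm0 mulr0.
(* [c *: G] is the projection of [F] onto the line of [G]. *)
pose c := L2dot F G / (L2norm G ^+ 2)%:C.
have g0 : (L2norm G ^+ 2)%:C != 0 :> R[i].
  by rewrite (inj_eq (@complexI R)) sqrf_eq0.
have orth : L2dot (F - c *: G) (c *: G) = 0.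
  by rewrite L2dotZr L2dotBl L2dotZl L2dotFF /c divfK// subrr mulr0.
have := L2pythagoras orth; rewrite subrK => Fe.
have : L2norm (c *: G) ^+ 2 <= L2norm F ^+ 2 by rewrite Fe lerDr sqr_ge0.
rewrite ler_pXn2r ?nnegrE ?L2norm_ge0// L2normZ => h.
have -> : L2dot F G = c * (L2norm G ^+ 2)%:C by rewrite divfK.
rewrite normcM normc_real ger0_norm ?sqr_ge0// expr2 mulrA.
by rewrite ler_wpM2r ?L2norm_ge0.
Qed.

(** Dividing by the norm: a bound on the quadratic form at [F] linear in the norm
    of [F] bounds that norm. It turns estimates by duality into norm estimates. *)
Lemma L2norm_le_dot F (M : R) : 0 <= M ->
  normc (L2dot F F) <= M * L2norm F -> L2norm F <= M.
Proof.
move=> M0; rewrite L2dotFF normc_real ger0_norm ?sqr_ge0// expr2.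
have [->//|F0] := eqVneq (L2norm F) 0.
by rewrite ler_pM2r// lt_def F0 L2norm_ge0.
Qed.

End InnerProduct.

(** * Completeness of L2 *)
Section Completeness.
Context d (T : measurableType d) (R : realType).
Variable mu : {measure set T -> \bar R}.
Local Notation Re := complex.Re.
Local Notation Im := complex.Im.
Implicit Types (F G : L2 mu).

Lemma cvgn_bounded_variation (a : R^nat) (C : R) :
  (forall N, \sum_(0 <= n < N) `|a n.+1 - a n| <= C) -> cvgn a.
Proof.
move=> aC.
have -> : a = (fun=> a 0%N) + series (telescope a).
  by apply/funext => n; rewrite [LHS]eq_sum_telescope.
apply: is_cvgD; first exact: is_cvg_cst.
apply: (@normed_cvg R R^o).
apply: nondecreasing_is_cvgn.
  by apply/nondecreasing_seqP => n; rewrite /= /series/= big_nat_recr//= lerDl.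
by exists C => _ [n _ <-]; exact: aC.
Qed.

Lemma sum_half_le2 (N : nat) : \sum_(0 <= n < N) (2^-1 : R) ^+ n <= 2.
Proof.
have := @geometric_le_lim R N 1 2^-1 ler01.
rewrite invr_gt0 ltr0n ger0_norm ?invr_ge0// => /(_ isT).
rewrite invf_lt1// ltr1n => /(_ isT).
rewrite /series /= mul1r.
under eq_bigr do rewrite mul1r.
have -> : (1 - 2^-1) = 2^-1 :> R by lra.
by rewrite invrK.
Qed.

(** The arithmetic-geometric mean inequality with weight [2 ^ n]: it makes the
    increments of a sequence summable as soon as their squares, weighted by
    [2 ^ n], are. *)
Lemma le_weighted_sqr (a : R) n : a <= 2 ^+ n * a ^+ 2 + 2^-1 ^+ n.
Proof.
have w0 : 0 < 2 ^+ n :> R by rewrite exprn_gt0.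
rewrite exprVn -subr_ge0; set w := 2 ^+ n in w0 *.
have -> : w * a ^+ 2 + w^-1 - a = w^-1 * ((w * a - 2^-1) ^+ 2 + 3 / 4).
  by field; rewrite gt_eqF.
by rewrite mulr_ge0 ?invr_ge0 ?(ltW w0)// addr_ge0 ?sqr_ge0.
Qed.

(** The increments have weighted squares with finite total integral, so that
    almost everywhere the sum of weighted squares is finite, and the sequence
    has bounded variation. *)
Lemma L2fun_ae_cvg (u : nat -> L2fun mu) :
  (forall n, \int[mu]_x (normc (u n.+1 x - u n x) ^+ 2)%:E <=
             (16^-1 ^+ n)%:E)%E ->
  {ae mu, forall x, cvgn (fun n => Re (u n x)) /\ cvgn (fun n => Im (u n x))}.
Proof.
move=> u16.
pose h n x : \bar R := ((2 ^+ n * normc (u n.+1 x - u n x) ^+ 2)%:E)%E.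
have h0 n x : (0 <= h n x)%E.
  by rewrite lee_fin mulr_ge0 ?sqr_ge0 ?exprn_ge0.
have md n : measurable_fun setT (fun x => normc (u n.+1 x - u n x)).
  by apply: cmeasurable_normc; exact: (L2fun_cmeasurable (u n.+1 - u n)).
have mh n : measurable_fun setT (h n).
  apply/measurable_EFinP; apply: measurable_funM => //.
  exact: measurable_funX.
have sh0 x : (0 <= \sum_(n <oo) h n x)%E by apply: nneseries_ge0 => n _ _.
have ih : mu.-integrable setT (fun x => \sum_(n <oo) h n x)%E.
  apply/integrableP; split.
    exact: (ge0_emeasurable_sum (P := xpredT)).
  under eq_integral do rewrite gee0_abs//.
  rewrite integral_nneseries//.
  apply: (@le_lt_trans _ _ 2%:E); last exact: ltry.
  apply: lime_le.
    by apply: is_cvg_nneseries => n _ _; exact: integral_ge0.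
  apply: nearW => N.
  apply: (@le_trans _ _ (\sum_(0 <= n < N) (2^-1 ^+ n)%:E)%E); last first.
    by rewrite sumEFin lee_fin sum_half_le2.
  apply: lee_sum => n _.
  under eq_integral do rewrite /h EFinM.
  rewrite ge0_integralZl//; first last.
  - by move=> x _; rewrite lee_fin sqr_ge0.
  - by apply/measurable_EFinP; exact: measurable_funX.
  apply: (@le_trans _ _ ((2 ^+ n)%:E * (16^-1 ^+ n)%:E)%E).
    by rewrite lee_pmul2l// lte_fin exprn_gt0.
  rewrite -EFinM lee_fin -exprMn lerXn2r ?nnegrE//; lra.
have := integrable_ae measurableT ih; apply: filterS => x /(_ I) fin.
have [C hC] : exists C, forall N,
    \sum_(0 <= n < N) normc (u n.+1 x - u n x) <= C.
  exists (fine (\sum_(n <oo) h n x)%E + 2) => N.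
  apply: (@le_trans _ _ (\sum_(0 <= n < N)
      (2 ^+ n * normc (u n.+1 x - u n x) ^+ 2 + 2^-1 ^+ n))).
    by apply: ler_sum => n _; exact: le_weighted_sqr.
  rewrite big_split/= lerD ?sum_half_le2// -lee_fin fineK// -sumEFin.
  by apply: nneseries_lim_ge => k _ _; exact: h0.
by split; apply: (cvgn_bounded_variation (C := C)) => N;
  apply: le_trans (hC N); apply: ler_sum => n _; rewrite -raddfB;
  [exact: ler_Re_normc|exact: ler_Im_normc].
Qed.


(** The almost everywhere limit is also the limit in mean, by Fatou's lemma
    applied to the distances to a fixed term. *)
Lemma L2_fast_cauchy_cvg (F : nat -> L2 mu) :
  (forall n, L2norm (F n.+1 - F n) <= 4^-1 ^+ n) ->
  exists G, forall n, L2norm (G - F n) <= 2 * 4^-1 ^+ n.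
Proof.
move=> F4; pose u n : L2fun mu := repr (F n).
have FE n : F n = L2class (u n) by rewrite L2class_repr.
have uB m n : (\int[mu]_x (normc (u m x - u n x) ^+ 2)%:E =
    (L2norm (F m - F n) ^+ 2)%:E)%E.
  rewrite !FE (_ : _ - _ = L2class (u m - u n)) ?L2norm_sqr_class//.
  exact/esym/L2classB.
have Fmn n m : L2norm (F (m + n)%N - F n) <= 2 * (1 - 4^-1 ^+ m) * 4^-1 ^+ n.
  elim: m => [|m ih]; first by rewrite subrr L2norm0 expr0 subrr mulr0 mul0r.
  rewrite (le_trans (L2norm_triangle _ (F (m + n)%N) _))//.
  apply: le_trans (lerD (F4 (m + n)%N) ih) _.
  rewrite exprD exprS; set a := 4^-1 ^+ m; set b := 4^-1 ^+ n.
  have : 0 <= a * b by rewrite mulr_ge0 ?exprn_ge0.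
  lra.
have mRe n : measurable_fun setT (fun x => (Re (u n x))%:E).
  by apply/measurable_EFinP; case: (L2fun_cmeasurable (u n)).
have mIm n : measurable_fun setT (fun x => (Im (u n x))%:E).
  by apply/measurable_EFinP; case: (L2fun_cmeasurable (u n)).
have ucvg : {ae mu, forall x,
    cvgn (fun n => Re (u n x)) /\ cvgn (fun n => Im (u n x))}.
  apply: L2fun_ae_cvg => n; rewrite uB lee_fin.
  rewrite (_ : 16^-1 = 4^-1 * 4^-1); last by lra.
  by rewrite exprMn -expr2 lerXn2r ?nnegrE ?L2norm_ge0 ?exprn_ge0.
(* The upper limit is measurable everywhere, and the limit where there is one. *)
pose U x := fine (limn_esup (fun n => (Re (u n x))%:E)) +i*
            fine (limn_esup (fun n => (Im (u n x))%:E)).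
have mU : cmeasurable U.
  split; apply: (measurableT_comp (fine_measurable measurableT));
    exact: measurable_fun_limn_esup.
have fine_esup (a : R^nat) : cvgn a -> a @ \oo --> fine (limn_esup (EFin \o a)).
  move=> /cvg_ex[l al]; have : (EFin \o a) @ \oo --> l%:E.
    by apply: cvg_EFin => //; exact: nearW.
  by move=> /cvg_limn_einf_sup[_ ->].
have sqr_shift (a : R^nat) (b l : R) n : a @ \oo --> l ->
    (fun m => (a (m + n)%N - b) ^+ 2) @ \oo --> (l - b) ^+ 2.
  move=> al; have abl : (fun m => a (m + n)%N - b) @ \oo --> l - b.
    apply: cvgB; last exact: cvg_cst.
    by move: al; rewrite -(cvg_shiftn n).
  by rewrite expr2; under eq_fun do rewrite expr2; exact: cvgM.
have Ucvg : {ae mu, forall x, forall n,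
    (fun m => (normc (u (m + n)%N x - u n x) ^+ 2)%:E) @ \oo -->
    (normc (U x - u n x) ^+ 2)%:E}.
  apply: filterS ucvg => x [/fine_esup cr /fine_esup ci] n.
  apply: cvg_EFin; first by exact: nearW.
  under eq_fun do rewrite /= normc_sqrE !raddfB.
  rewrite normc_sqrE !raddfB.
  exact: (cvgD (sqr_shift _ (Re (u n x)) _ n cr)
    (sqr_shift _ (Im (u n x)) _ n ci)).
have mB m n : measurable_fun setT
    (fun x => (normc (u m x - u n x) ^+ 2)%:E).
  apply/measurable_EFinP; apply: measurable_funX; apply: cmeasurable_normc.
  exact: (L2fun_cmeasurable (u m - u n)).
have mUB n : cmeasurable (fun x => U x - u n x).
  apply: cmeasurableD => //.
  exact: (L2fun_cmeasurable (- u n)).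
have Uu n : (\int[mu]_x (normc (U x - u n x) ^+ 2)%:E <=
    ((2 * 4^-1 ^+ n) ^+ 2)%:E)%E.
  apply: (@le_trans _ _ (\int[mu]_x
      limn_einf (fun m => (normc (u (m + n)%N x - u n x) ^+ 2)%:E)))%E.
    apply: ae_ge0_le_integral => //.
    - by move=> x _; rewrite lee_fin sqr_ge0.
    - apply/measurable_EFinP; apply: measurable_funX.
      exact: cmeasurable_normc.
    - by move=> x _; rewrite limn_einf_lim; apply: lime_ge;
        [exact: is_cvg_einfs|apply: nearW => m; apply: le_ereal_inf_tmp => _
         [k _ <-]; rewrite lee_fin sqr_ge0].
    - apply: measurableT_comp => //; apply: measurable_fun_limn_esup => m.
      by apply: measurableT_comp => //; exact: mB.
    - apply: filterS Ucvg => x /(_ n) /cvg_limn_einf_sup[-> _] _.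
      exact: lexx.
  apply: le_trans (fatou mu measurableT (fun m => mB (m + n)%N n) _) _.
    by move=> m x _; rewrite lee_fin sqr_ge0.
  rewrite limn_einf_lim; apply: lime_le; first exact: is_cvg_einfs.
  apply: nearW => m; apply: (@le_trans _ _ (\int[mu]_x
      (normc (u (m + n)%N x - u n x) ^+ 2)%:E)%E).
    by apply: ereal_inf_lbound; exists m => //=.
  rewrite uB lee_fin lerXn2r ?nnegrE ?L2norm_ge0 ?mulr_ge0 ?exprn_ge0//.
  rewrite (le_trans (Fmn n m))// ler_wpM2r ?exprn_ge0//.
  by rewrite ler_piMr// lerBlDr lerDl exprn_ge0.
have UB n : (fun x => U x - u n x) \in cLfun mu 2%:E.
  by apply: cLfun2_sqr => //; rewrite (le_lt_trans (Uu n))// ltry.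
have UL : U \in cLfun mu 2%:E.
  have := proj2 (cLfun2_submod_closed mu) 1 _ _ (UB 0) (L2funP (u 0)).
  rewrite (_ : 1 *: _ + _ = U)//; apply/funext => x.
  by rewrite [LHS](_ : _ = 1 * (U x - u 0 x) + u 0 x)// mul1r subrK.
exists (L2class (MkL2fun UL)) => n.
rewrite -(@ler_pXn2r _ 2)// ?nnegrE ?L2norm_ge0 ?mulr_ge0 ?exprn_ge0//.
rewrite -lee_fin FE (_ : _ - _ = L2class (MkL2fun UL - u n)).
  by rewrite L2norm_sqr_class; exact: Uu.
exact/esym/L2classB.
Qed.


(** A Cauchy sequence has a subsequence with geometrically small increments. *)
Lemma L2_complete (F : nat -> L2 mu) :
  (forall e, 0 < e -> exists N, forall m n, (N <= m)%N -> (N <= n)%N ->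
    L2norm (F m - F n) <= e) ->
  exists G, forall e, 0 < e -> exists N, forall n, (N <= n)%N ->
    L2norm (G - F n) <= e.
Proof.
move=> cF.
have [N0 HN0] : {N0 : nat -> nat & forall k m n, (N0 k <= m)%N ->
    (N0 k <= n)%N -> L2norm (F m - F n) <= 4^-1 ^+ k}.
  by apply: (@choice _ _ (fun k N0 => forall m n, (N0 <= m)%N ->
    (N0 <= n)%N -> L2norm (F m - F n) <= 4^-1 ^+ k)) => k; apply: cF;
    rewrite exprn_gt0.
(* Partial sums make the thresholds nondecreasing. *)
pose M k := (\sum_(0 <= j < k.+1) N0 j)%N.
have NM k : (N0 k <= M k)%N by rewrite /M big_nat_recr//= leq_addl.
have MS k : (M k <= M k.+1)%N by rewrite /M [leqRHS]big_nat_recr//= leq_addr.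
have [|G HG] := @L2_fast_cauchy_cvg (F \o M).
  by move=> k; apply: HN0; rewrite ?NM// (leq_trans (NM k)).
(* [e / 3]: the Cauchy estimate costs one [4^-1 ^+ k], the limit two. *)
exists G => e e0.
have [k hk] : exists k, 4^-1 ^+ k < e / 3.
  have : (fun k => geometric 1 (4^-1 : R) k) @ \oo --> 0.
    by apply: cvg_geometric; rewrite ger0_norm ?invr_ge0// invf_lt1// ltr1n.
  move=> /cvgrPdist_lt/(_ (e / 3)); rewrite divr_gt0// => /(_ isT)[k _ hk].
  exists k; have := hk k (leqnn k).
  by rewrite /= mul1r sub0r normrN ger0_norm ?exprn_ge0.
exists (N0 k) => n kn.
rewrite (le_trans (L2norm_triangle _ (F (M k)) _))//.
have := HG k; have := HN0 k (M k) n (NM k) kn; rewrite /=.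
by move: hk; lra.
Qed.

End Completeness.

(** * Integrals of characters over the torus *)
Section TorusMeasure.
Context {R : realType}.
Local Notation RT := (measurableTypeR R).
Local Notation U := (uniform_prob (circle_lt R)).

(** The half-line [x < a] is an arc only for angles strictly inside the period,
    and limits of trigonometric polynomials miss its end point; both exceptional
    sets are null. *)
Lemma uniform_ae (a : R) : {ae U, forall x, 0 < x < 2 * pi /\ x != a}.
Proof.
pose N : set RT := ~` (`]0, 2 * pi[%classic `\ a).
have mN : measurable N.
  apply: measurableC; apply: measurableD; first exact: measurable_itv.
  exact: measurable_set1.
exists N; split => //.
- rewrite /= /uniform_prob integral_uniform_pdf.
  have sN : N `&` `[0, 2 * pi] `<=` [set 0; 2 * pi; a].
    move=> x /= [nx]; rewrite in_itv/= => /andP[x0 x2].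
    have [->|xa] := eqVneq x a; first by right.
    left; have [->|x0'] := eqVneq x 0; first by left.
    right; apply/eqP; apply/negPn/negP => x2'; apply: nx; split.
      by rewrite /= in_itv/= !lt_neqAle x0 x2 x2' eq_sym x0'.
    by move/eqP: xa.
  apply: null_set_integral.
  + by apply: measurableI => //; exact: measurable_itv.
  + apply/measurable_EFinP; apply: measurable_funTS.
    exact: measurable_uniform_pdf.
  + apply: countable_lebesgue_measure0; apply: sub_countable (subset_card_le sN) _.
    by apply: finite_set_countable.
- move=> x /= h [] /=; rewrite in_itv/= => x0 xa; apply: h; split => //.
  by apply/eqP.
Qed.

Lemma sin_intr_2pi (k : int) (c : R) : sin (k%:~R * (2 * pi) + c) = sin c.
Proof.
have nat_case (n : nat) (a : R) : sin (a + n%:R * (2 * pi)) = sin a.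
  have -> : n%:R * (2 * pi) = (pi *+ 2) *+ n :> R.
    by rewrite -(mulr_natl pi) mulr_natl.
  exact: (periodicn (@sinD2pi R)).
case: k => n; first by rewrite addrC nat_case.
by rewrite NegzE intrN mulNr addrC -(nat_case n.+1 (c - _)) subrK.
Qed.

(** Adding [1] makes the integrand nonnegative, so that integrals
    can be iterated in any order without integrability conditions. *)
Lemma integral_uniform_1Dcos (k : int) (c : R) : k != 0 ->
  (\int[U]_x (1 + cos (k%:~R * x + c))%:E = 1)%E.
Proof.
move=> k0; have kR : k%:~R != 0 :> R by rewrite intr_eq0.
have mcos : measurable_fun setT (fun x : RT => 1 + cos (k%:~R * x + c)).
  apply: measurable_funD => //.
  apply: (@measurableT_comp _ _ _ _ _ _ (@cos R)).
    by apply: continuous_measurable_fun; exact: continuous_cos.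
  by apply: measurable_funD => //; exact: measurable_funM.
rewrite integral_uniform//=; last first.
  exact/measurable_EFinP.
pose F (x : R) := x + (k%:~R)^-1 * sin (k%:~R * x + c).
have dL (x : R) : is_derive x 1 (fun x : R => k%:~R * x + c) k%:~R.
  by apply: is_derive_eq; rewrite addr0 -[_ *: _]/(_ * _) mulr1.
have dF (x : R) : is_derive x 1 F (1 + cos (k%:~R * x + c)).
  apply: is_deriveD.
  have := @is_derive1_comp _ sin (fun x : R => k%:~R * x + c) x _ _ _ (dL x).
  move=> /(_ _ (is_derive_sin _)) dS.
  have := @is_deriveZ _ _ _ _ (k%:~R)^-1 _ _ _ dS.
  by rewrite -[_ *: (_ * _)]/(_ * (_ * _)) mulrCA mulVf// mulr1.
have Fc : continuous F.
  by move=> x; apply: differentiable_continuous; apply/derivable1_diffP; case: (dF x).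
rewrite (@continuous_FTC2 _ _ F); first last.
- by move=> x _; rewrite derive1E; have -> := @derive_val _ _ _ _ _ _ _ (dF x).
- split.
  + by move=> x _; case: (dF x).
  + exact/cvg_at_right_filter/Fc.
  + exact/cvg_at_left_filter/Fc.
- apply: continuous_subspaceT => x; apply: continuousD; first exact: cst_continuous.
  apply: continuous_comp; last exact: continuous_cos.
  by apply: differentiable_continuous; apply/derivable1_diffP; case: (dL x).
- exact: circle_lt.
rewrite -EFinB -EFinM; congr EFin; rewrite /F subr0 mulr0 !add0r.
by rewrite sin_intr_2pi addrK mulVf// gt_eqF// circle_lt.
Qed.

Lemma phase_cons n (k : 'I_n.+1 -> int) (z : RT * n.-tuple RT) :
  phase k (tuple_cons z) =
  (k ord0)%:~R * z.1 + phase (fun j => k (lift ord0 j)) z.2.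
Proof.
rewrite /phase big_ord_recl; congr (_ + _).
by apply: eq_bigr => j _; rewrite /tuple_cons tnthS.
Qed.

Lemma measurable_cos_phase n (k : 'I_n -> int) (c : R) :
  measurable_fun setT (fun x : n.-tuple RT => cos (phase k x + c)).
Proof.
apply: (@measurableT_comp _ _ _ _ _ _ (@cos R)).
  by apply: continuous_measurable_fun; exact: continuous_cos.
by apply: measurable_funD => //; exact: measurable_phase.
Qed.

(** By induction on the dimension, integrating first over the variables that
    contain a nonzero frequency; the phase [c] absorbs the other variables. *)
Lemma integral_torus_1Dcos n (k : 'I_n -> int) (c : R) :
  (exists j, k j != 0) ->
  (\int[torus_measure R n]_x (1 + cos (phase k x + c))%:E = 1)%E.
Proof.
have cos0 (a : R) : (0 <= (1 + cos a)%:E)%E.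
  by rewrite lee_fin -lerBlDl sub0r cos_geN1.
elim: n k c => [|n IH] k c [j kj0]; first by case: j kj0.
have mF : measurable_fun setT
    (fun x : n.+1.-tuple RT => (1 + cos (phase k x + c))%:E).
  apply/measurable_EFinP; apply: measurable_funD => //.
  exact: measurable_cos_phase.
rewrite /= ge0_integral_distribution//.
have mFc : measurable_fun setT ((fun x : n.+1.-tuple RT =>
    (1 + cos (phase k x + c))%:E) \o @tuple_cons R n).
  by apply: measurableT_comp => //; exact: measurable_tuple_cons.
have one (d : measure_display) (T : measurableType d) (P : probability T R) :
    (\int[P]_x (1 : \bar R) = 1)%E.
  by rewrite integral_cst// mul1e; exact: probability_setT.
(* The inner integral is over the remaining variables if the first frequency is
   zero, and over the first variable otherwise. *)
have [k00|k00] := eqVneq (k ord0) 0.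
  rewrite fubini_tonelli1//= -[RHS](one _ _ (uniform_prob (circle_lt R))).
  apply: eq_integral => x _.
  transitivity (\int[torus_measure R n]_y
      (1 + cos (phase (fun i => k (lift ord0 i)) y + ((k ord0)%:~R * x + c)))%:E)%E.
    by apply: eq_integral => y _; rewrite /= phase_cons /= addrCA addrA.
  apply: IH; case: (unliftP ord0 j) kj0 => [i ->|->]; first by exists i.
  by rewrite k00 eqxx.
rewrite fubini_tonelli2//= -[RHS](one _ _ (torus_measure R n)).
apply: eq_integral => y _.
rewrite -(integral_uniform_1Dcos (phase (fun i => k (lift ord0 i)) y + c) k00).
by apply: eq_integral => x _; rewrite /= phase_cons /= addrA.
Qed.

End TorusMeasure.

(** * Trigonometric polynomials *)
Section TrigonometricPolynomials.
Context {R : realType}.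
Local Notation RT := (measurableTypeR R).

(** Every one-dimensional marginal of the measure of the torus is uniform, hence
    a null set in one coordinate is null. *)
Lemma torus_ae n (j : 'I_n) (P : RT -> Prop) :
  {ae uniform_prob (circle_lt R), forall x, P x} ->
  {ae torus_measure R n, forall x, P (tnth x j)}.
Proof.
move=> [N [mN N0 sN]].
have mNj i (l : 'I_i) :
    measurable ([set x : i.-tuple RT | N (tnth x l)]).
  have := measurable_tnth (T := RT) (n := i) l measurableT mN.
  by rewrite setTI.
exists [set x | N (tnth x j)]; split; [exact: mNj| |by move=> x /= Px; apply: sN].
elim: n j {sN} => [[]//|n IH] j.
change ((uniform_prob (circle_lt R) \x torus_measure R n)%E
  (@tuple_cons R n @^-1` [set x | N (tnth x j)]) = 0).
have [->|[i ->]] : j = ord0 \/ exists i : 'I_n, j = lift ord0 i.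
- by case: (unliftP ord0 j) => [i|]; [right; exists i|left].
- rewrite (_ : _ @^-1` _ = N `*` setT); last first.
    by apply/seteqP; split => [[x y]/= Nx//|[x y]/= []].
  by rewrite product_measure1E// [X in (X * _)%E]N0 mul0e.
- rewrite (_ : _ @^-1` _ = setT `*` [set y | N (tnth y i)]); last first.
    by apply/seteqP; split => [[x y]|[x y] []] /=; rewrite /tuple_cons tnthS.
  by rewrite (product_measure1E _ _ measurableT (mNj n i)) [X in (_ * X)%E]IH mule0.
Qed.

Context {n : nat}.
Local Notation mu := (torus_measure R n).
Local Notation T := (n.-tuple RT).

(** Real trigonometric polynomials as sums of phase-shifted cosines: the phase
    covers sines, and the product formula for cosines keeps the class stable
    under multiplication. *)
Inductive trig_poly : (T -> R) -> Prop :=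
| trig_poly0 : trig_poly (fun=> 0)
| trig_polyD a k c g : trig_poly g ->
    trig_poly (fun x => a * cos (phase k x + c) + g x).

Lemma trig_poly_add f g :
  trig_poly f -> trig_poly g -> trig_poly (fun x => f x + g x).
Proof.
move=> tf tg; elim: tf => [|a k c h _ ih].
  by under eq_fun do rewrite add0r.
by under eq_fun do rewrite -addrA; exact: trig_polyD.
Qed.

Lemma trig_poly_cos a k c : trig_poly (fun x => a * cos (phase k x + c)).
Proof.
by have := trig_polyD a k c trig_poly0; under eq_fun do rewrite addr0.
Qed.

Lemma cos_mul_cos (a b : R) : cos a * cos b = 2^-1 * cos (a + b) + 2^-1 * cos (a - b).
Proof. by rewrite cosD cosB; lra. Qed.

Lemma phaseD (k l : 'I_n -> int) x :
  phase (fun j => k j + l j) x = phase k x + phase l x :> R.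
Proof.
by rewrite -big_split; apply: eq_bigr => j _; rewrite intrD mulrDl.
Qed.

Lemma phaseN (k : 'I_n -> int) x : phase (fun j => - k j) x = - phase k x :> R.
Proof.
by rewrite -sumrN; apply: eq_bigr => j _; rewrite intrN mulNr.
Qed.

Lemma phase0 x : phase (fun _ : 'I_n => 0) x = 0 :> R.
Proof. by rewrite /phase big1// => j _; rewrite mul0r. Qed.

Lemma trig_poly_cosM a k c g : trig_poly g ->
  trig_poly (fun x => a * cos (phase k x + c) * g x).
Proof.
elim=> [|b l e h _ ih].
  by under eq_fun do rewrite mulr0; exact: trig_poly0.
have := trig_polyD (a * b / 2) (fun j => k j + l j) (c + e)
  (trig_polyD (a * b / 2) (fun j => k j + - l j) (c - e) ih).
congr trig_poly; apply/funext => x.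
rewrite !phaseD phaseN mulrDr mulrACA cos_mul_cos addrA; congr (_ + _).
rewrite mulrDr !mulrA; congr (_ * cos _ + _ * cos _); ring.
Qed.

Lemma trig_poly_mul f g :
  trig_poly f -> trig_poly g -> trig_poly (fun x => f x * g x).
Proof.
move=> tf tg; elim: tf => [|a k c h _ ih].
  by under eq_fun do rewrite mul0r; exact: trig_poly0.
under eq_fun do rewrite mulrDl.
by apply: trig_poly_add => //; exact: trig_poly_cosM.
Qed.

Lemma trig_poly_cst a : trig_poly (fun=> a).
Proof.
have := trig_poly_cos a (fun=> 0) 0; congr trig_poly; apply/funext => x.
by rewrite phase0 addr0 cos0 mulr1.
Qed.

Lemma trig_poly_exp f m : trig_poly f -> trig_poly (fun x => f x ^+ m).
Proof.
move=> tf; elim: m => [|m ih].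
  by under eq_fun do rewrite expr0; exact: trig_poly_cst.
by under eq_fun do rewrite exprS; exact: trig_poly_mul.
Qed.

Lemma trig_poly_coord a (j : 'I_n) c :
  trig_poly (fun x => a * cos (tnth x j + c)).
Proof.
have := trig_poly_cos a (fun i => (i == j)%:Z) c; congr trig_poly.
apply/funext => x; rewrite /phase (bigD1 j)//= eqxx mul1r big1 ?addr0//.
by move=> i /negPf ->; rewrite mul0r.
Qed.

Lemma measurable_trig_poly f : trig_poly f -> measurable_fun setT f.
Proof.
elim=> [|a k c g _ mg]; first exact: measurable_cst.
by apply: measurable_funD => //; apply: measurable_funM => //;
  exact: measurable_cos_phase.
Qed.

Lemma trig_poly_bounded f : trig_poly f ->
  exists M, forall x, `|f x| <= M.
Proof.
elim=> [|a k c g _ [M gM]]; first by exists 0 => x; rewrite normr0.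
exists (`|a| + M) => x; rewrite (le_trans (ler_normD _ _))// lerD//.
by rewrite normrM ler_piMr// cos_max.
Qed.

Lemma bernoulli_inequality (h : R) m : -1 <= h -> 1 + m%:R * h <= (1 + h) ^+ m.
Proof.
move=> h1; elim: m => [|m ih]; first by rewrite mul0r addr0 expr0.
have h0 : 0 <= 1 + h by lra.
rewrite exprS (le_trans _ (ler_wpM2l h0 ih))// mulrDr mulr1 -natr1.
have : 0 <= m%:R * h ^+ 2 :> R by rewrite mulr_ge0 ?sqr_ge0.
by rewrite mulrDl !mulrDl; lra.
Qed.

(** Together with [threshold_cvg0]: the polynomials [(1 - t ^ m) ^ (2 ^ m)] stay
    in [[0, 1]] and tend to the indicator of [t < 1/2]. Bernoulli's inequality
    bounds them below by [1 - (2 t) ^ m]. *)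
Lemma threshold_cvg1 (t : R) : 0 <= t < 2^-1 ->
  (fun m => (1 - t ^+ m) ^+ (2 ^ m)) @ \oo --> (1 : R).
Proof.
move=> /andP[t0 t2].
have t1 m : t ^+ m <= 1 by rewrite exprn_ile1//; lra.
have g : (fun m => 1 - geometric 1 (2 * t) m) @ \oo --> (1 : R).
  rewrite -[X in _ --> X]subr0; apply: cvgB; first exact: cvg_cst.
  by apply: cvg_geometric; rewrite ger0_norm; lra.
apply: (squeeze_cvgr (h := fun=> 1)) g (cvg_cst _).
apply: nearW => m; rewrite exprn_ile1 ?andbT; last 2 first.
- by rewrite subr_ge0.
- by rewrite lerBlDr lerDl exprn_ge0.
have := @bernoulli_inequality (- t ^+ m) (2 ^ m).
by rewrite lerN2 natrX mulrN -exprMn /= mul1r; apply.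
Qed.

(** As [(1 - s) ^ N (1 + s) ^ N <= 1], Bernoulli's inequality for [1 + s] bounds
    the sequence by [(2 t) ^ - m]. *)
Lemma threshold_cvg0 (t : R) : 2^-1 < t <= 1 ->
  (fun m => (1 - t ^+ m) ^+ (2 ^ m)) @ \oo --> (0 : R).
Proof.
move=> /andP[t2 t1]; have t0 : 0 < t by lra.
have tm1 m : t ^+ m <= 1 by rewrite exprn_ile1//; lra.
have g : (fun m => geometric 1 (2 * t)^-1 m) @ \oo --> (0 : R).
  apply: cvg_geometric; rewrite ger0_norm ?invr_ge0; last by lra.
  by rewrite invf_lt1; lra.
apply: (squeeze_cvgr (f := fun=> 0)) (cvg_cst _) g.
apply: nearW => m; rewrite exprn_ge0 ?subr_ge0//=.
have p m' : 0 < (2 * t) ^+ m' by rewrite exprn_gt0//; lra.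
rewrite mul1r exprVn -[leRHS]mul1r ler_pdivlMr//.
have b : (2 * t) ^+ m <= (1 + t ^+ m) ^+ (2 ^ m).
  apply: (@le_trans _ _ (1 + (2 ^ m)%:R * t ^+ m)).
    by rewrite natrX -exprMn lerDr.
  apply: bernoulli_inequality; apply: (@le_trans _ _ 0).
    by rewrite lerN10.
  by rewrite exprn_ge0// ltW.
rewrite (le_trans (ler_wpM2l _ b)) ?exprn_ge0 ?subr_ge0//.
rewrite -exprMn -subr_sqr expr1n exprn_ile1// ?subr_ge0.
  by rewrite exprn_ile1// exprn_ge0// ltW.
by rewrite lerBlDr lerDl exprn_ge0// exprn_ge0// ltW.
Qed.

End TrigonometricPolynomials.

(** * Uniqueness of Fourier coefficients *)
Section FourierUniqueness.
Context {R : realType} {n : nat}.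
Local Notation RT := (measurableTypeR R).
Local Notation mu := (torus_measure R n).
Local Notation T := (n.-tuple RT).

(** Sets whose indicator is a bounded pointwise limit of trigonometric polynomials,
    up to a null set. They form a pi-system, because trigonometric polynomials
    are stable under product. *)
Definition trig_limit : set (set T) := [set E | exists t : nat -> T -> R,
  [/\ forall m, trig_poly (t m), forall m x, 0 <= t m x <= 1 &
      {ae mu, forall x, (fun m => t m x) @ \oo --> (\1_E x : R)}]].

Lemma trig_limitI : setI_closed trig_limit.
Proof.
move=> E F [t [tp t01 tE]] [s [sp s01 sF]].
exists (fun m x => t m x * s m x); split.
- by move=> m; exact: trig_poly_mul.
- move=> m x; have /andP[? ?] := t01 m x; have /andP[? ?] := s01 m x.
  by rewrite mulr_ge0//= mulr_ile1.
- apply: filterS2 tE sF => x tx sx; rewrite indicI /=.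
  exact: cvgM.
Qed.

Lemma trig_limit0 (E : set T) : {ae mu, forall x, ~ E x} -> trig_limit E.
Proof.
move=> E0; exists (fun _ _ => 0); split.
- by move=> _; exact: trig_poly0.
- by move=> _ _; rewrite lexx ler01.
- apply: filterS E0 => x Ex; rewrite indicE memNset//; exact: cvg_cst.
Qed.

Lemma trig_limit1 (E : set T) : {ae mu, forall x, E x} -> trig_limit E.
Proof.
move=> E0; exists (fun _ _ => 1); split.
- by move=> _; exact: trig_poly_cst.
- by move=> _ _; rewrite lexx ler01.
- apply: filterS E0 => x Ex; rewrite indicE mem_set//; exact: cvg_cst.
Qed.

(** On the circle, the arc from [0] to [a] is where the cosine of the distance to
    its midpoint [a / 2] exceeds [cos (a / 2)]. *)
Lemma cos_half_lt (a x : R) : 0 < a < 2 * pi -> 0 < x < 2 * pi -> x != a ->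
  if x < a then cos (a / 2) < cos (x - a / 2) else cos (x - a / 2) < cos (a / 2).
Proof.
move=> /andP[a0 a2] /andP[x0 x2]; have pi0 := pi_gt0 R.
have a2I : a / 2 \in `[0, pi] by rewrite in_itv/=; apply/andP; split; lra.
rewrite neq_lt => /orP[xa|ax].
  rewrite xa; have [h|h] := leP (a / 2) x.
    by rewrite ltr_cos// ?in_itv/=; [lra|apply/andP; split; lra].
  by rewrite -[cos (x - _)]cosN ltr_cos// ?in_itv/=; [lra|apply/andP; split; lra].
rewrite ltNge (ltW ax) /=; have [h|h] := leP (x - a / 2) pi.
  by rewrite ltr_cos// ?in_itv/=; [lra|apply/andP; split; lra].
rewrite -[cos (x - _)]cosN -(cosD2pi (- (x - a / 2))) -[pi *+ 2]mulr_natl.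
rewrite ltr_cos// ?in_itv/=; first lra.
by apply/andP; split; lra.
Qed.

(** The polynomial [g] below takes values in [[0, 1]] and is less than [1/2]
    exactly on the arc; the threshold polynomials are composed with it. *)
Lemma trig_limit_lt (j : 'I_n) (a : R) : trig_limit [set x | tnth x j < a].
Proof.
have [a0|a0] := leP a 0.
  apply: trig_limit0; apply: filterS (torus_ae j (uniform_ae a)) => x /=.
  by move=> [/andP[x0 _] _]; apply/negP; rewrite -leNgt (le_trans a0)// ltW.
have [a2|a2] := leP (2 * pi) a.
  apply: trig_limit1; apply: filterS (torus_ae j (uniform_ae a)) => x /=.
  by move=> [/andP[_ x2] _]; rewrite (lt_le_trans x2).
pose g (x : T) : R := 2^-1 + cos (a / 2) / 4 + - 4^-1 * cos (tnth x j + - (a / 2)).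
have tg : trig_poly g.
  by apply: trig_poly_add; [exact: trig_poly_cst|exact: trig_poly_coord].
have g01 x : 0 <= g x <= 1.
  have := cos_geN1 (a / 2); have := cos_geN1 (tnth x j + - (a / 2)).
  have := cos_le1 (a / 2); have := cos_le1 (tnth x j + - (a / 2)).
  by rewrite /g => *; apply/andP; split; lra.
exists (fun m x => (1 - g x ^+ m) ^+ (2 ^ m)); split.
- move=> m; apply: trig_poly_exp; apply: trig_poly_add.
    exact: trig_poly_cst.
  have := trig_poly_mul (trig_poly_cst (-1)) (trig_poly_exp m tg).
  by under eq_fun do rewrite mulN1r.
- move=> m x; have /andP[g0 g1] := g01 x.
  rewrite exprn_ge0 ?exprn_ile1 ?subr_ge0 ?exprn_ile1//.
  by rewrite lerBlDr lerDl exprn_ge0.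
- apply: filterS (torus_ae j (uniform_ae a)) => x /= [xI xa].
  have := @cos_half_lt a (tnth x j); rewrite a0 a2 => /(_ isT xI xa).
  have /andP[g0 g1] := g01 x; rewrite indicE.
  have [xlt|xlt] := ltP (tnth x j) a => h.
    rewrite mem_set//; apply: threshold_cvg1; rewrite g0 /g /=; lra.
  rewrite memNset; last by apply/negP; rewrite -leNgt.
  by apply: threshold_cvg0; rewrite g1 andbT /g; lra.
Qed.

Lemma measurable_torusE :
  @measurable _ T = <<s trig_limit `&` @measurable _ T >>.
Proof.
apply/seteqP; split; last first.
  apply: smallest_sub; first exact: sigma_algebra_measurable.
  exact: subIsetr.
pose G := trig_limit `&` @measurable _ T.
apply: smallest_sub; first exact: smallest_sigma_algebra.
elim/big_ind : _ => //=; first by move=> A B sA sB x [/sA|/sB].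
move=> j _ _ [B mB <-].
have : @measurable_fun _ _ (g_sigma_algebraType G) RT setT (fun x => tnth x j).
  apply: (measurability _ (RGenInftyO.measurableE R)).
  move=> _ [_ [a ->] <-]; apply: sub_sigma_algebra; rewrite setTI.
  have E : (fun x : T => tnth x j) @^-1` `]-oo, a[ = [set x | tnth x j < a].
    by apply/seteqP; split => x /=; rewrite in_itv.
  split; first by rewrite E; exact: trig_limit_lt.
  rewrite -[X in measurable X]setTI.
  exact: (measurable_tnth (T := RT) (n := n) j).
by move=> /(_ measurableT _ mB).
Qed.

Section Annihilator.
Variable u : T -> R.
Hypothesis iu : mu.-integrable setT (fun x => (u x)%:E).
Hypothesis u0 : forall k c,
  (\int[mu]_x (u x * cos (phase k x + c))%:E = 0)%E.

Let mu_ : measurable_fun setT u.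
Proof. by apply/measurable_EFinP; exact: measurable_int iu. Qed.

Let iuM (g : T -> R) (M : R) : measurable_fun setT g -> (forall x, `|g x| <= M) ->
  mu.-integrable setT (fun x => (u x * g x)%:E).
Proof.
move=> mg gM; have M0 : 0 <= M by rewrite (le_trans _ (gM point)).
have iM : mu.-integrable setT (fun x => (M%:E * (u x)%:E)%E).
  exact: integrableZl.
apply: le_integrable iM => //.
  by apply/measurable_EFinP; exact: measurable_funM.
move=> x _; rewrite -EFinM !abse_EFin lee_fin !normrM (ger0_norm M0) mulrC.
by rewrite ler_wpM2r.
Qed.

Lemma annihilate_trig_poly g : trig_poly g ->
  (\int[mu]_x (u x * g x)%:E = 0)%E.
Proof.
elim=> [|a k c h th ih].
  by under eq_integral do rewrite mulr0; rewrite integral0.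
have [M hM] := trig_poly_bounded th.
have ic : mu.-integrable setT (fun x => (u x * cos (phase k x + c))%:E).
  by apply: (@iuM _ 1) => [|x]; [exact: measurable_cos_phase|exact: cos_max].
under eq_integral do rewrite mulrDr mulrCA EFinD EFinM.
rewrite integralD//; last 2 first.
- exact: integrableZl.
- by apply: iuM hM; exact: measurable_trig_poly.
by rewrite integralZl// u0 mule0 ih add0e.
Qed.

Lemma annihilate_trig_limit (E : set T) : measurable E -> trig_limit E ->
  (\int[mu]_(x in E) (u x)%:E = 0)%E.
Proof.
move=> mE [t [tp t01 tE]].
have -> : (\int[mu]_(x in E) (u x)%:E = \int[mu]_x (u x * \1_E x)%:E)%E.
  rewrite integral_mkcond; apply: eq_integral => x _.
  rewrite patchE indicE; case: ifP => _; by rewrite ?mulr1 ?mulr0.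
have [|||||_ _] := @dominated_convergence _ _ _ mu setT measurableT
  (fun m x => (u x * t m x)%:E) (fun x => (u x * \1_E x)%:E)
  (fun x => `|u x|%:E).
- move=> m; apply/measurable_EFinP; apply: measurable_funM => //.
  exact: measurable_trig_poly.
- by apply/measurable_EFinP; apply: measurable_funM.
- apply: filterS tE => x tx _; apply: cvg_EFin; first exact: nearW.
  by apply: cvgM => //; exact: cvg_cst.
- by have := integrable_abse iu.
- apply: nearW => x m _; have /andP[? ?] := t01 m x.
  by rewrite abse_EFin lee_fin normrM ler_piMr// ger0_norm.
under eq_fun do rewrite annihilate_trig_poly//.
by move=> /(cvg_unique _ (cvg_cst _)) => /(_ (@ereal_hausdorff R)).
Qed.

(** By Dynkin's lemma, the integral of [u] vanishes over every measurable set, as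
    it does over the pi-system of limits of trigonometric polynomials. *)
Lemma annihilate_ae_eq0 : {ae mu, forall x, u x = 0}.
Proof.
suff : ae_eq mu setT (fun x => (u x)%:E) (cst 0%E).
  by apply: filterS => x /(_ I) [].
apply: integral_ae_eq => // E _ mE.
rewrite integral0; move: E mE; rewrite measurable_torusE.
have iuS (E : set T) : measurable E -> mu.-integrable E (fun x => (u x)%:E).
  by move=> mE; apply: integrableS iu.
have uT : (\int[mu]_x (u x)%:E = 0)%E.
  apply: annihilate_trig_limit => //; apply: trig_limit1; exact: nearW.
apply: dynkin_induction => //.
- exact: measurable_torusE.
- move=> A B [tA mA] [tB mB]; split; first exact: trig_limitI.
  exact: measurableI.
- by move=> A [tA mA]; exact: annihilate_trig_limit.
- move=> A mA A0; have := uT; rewrite -(setUv A) integral_setU//.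
  + by rewrite A0 add0e.
  + exact: measurableC.
  + rewrite setUv; exact: measurable_int iu.
  + by rewrite disj_set2E setICr.
- move=> F mF tF F0; rewrite integral_bigcup//.
    by apply: eseries0 => k _ _.
  by apply: iuS; exact: bigcupT_measurable.
Qed.

End Annihilator.

End FourierUniqueness.

(** * Orthonormal families *)
Section OrthonormalFamily.
Context d (T : measurableType d) (R : realType).
Variable mu : {measure set T -> \bar R}.
Variables (I : countType) (e : I -> L2 mu).
Hypothesis e_orthonormal : forall i j, L2dot (e i) (e j) = (i == j)%:R.
Implicit Types (F G : L2 mu) (a : I -> R[i]) (s : seq I).
Local Notation comb a s := (\sum_(i <- s) a i *: e i).

Lemma dot_comb a s j : uniq s ->
  L2dot (comb a s) (e j) = if j \in s then a j else 0.
Proof.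
move=> us; rewrite L2dot_suml.
under eq_bigr do rewrite L2dotZl e_orthonormal.
case: ifP => js.
  rewrite (bigD1_seq j)//= eqxx mulr1 big1_seq ?addr0// => i /andP[ij _].
  by rewrite (negPf ij) mulr0.
rewrite big1_seq// => i /andP[_ is_]; case: eqP => [ij|]; last by rewrite mulr0.
by rewrite ij js in is_.
Qed.

Lemma norm_comb a s : uniq s ->
  L2norm (comb a s) ^+ 2 = \sum_(i <- s) normc (a i) ^+ 2.
Proof.
move=> us; apply: complexI; rewrite -L2dotFF L2dot_sumr rmorph_sum /=.
rewrite big_seq [RHS]big_seq; apply: eq_bigr => i is_.
by rewrite L2dotZr dot_comb// is_ normc_sqr mulrC.
Qed.

Lemma dot_sub_comb F a s : uniq s ->
  L2dot (F - comb (fun i => L2dot F (e i)) s) (comb a s) = 0.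
Proof.
move=> us; rewrite L2dot_sumr big1_seq// => i /andP[_ is_].
by rewrite L2dotZr L2dotBl dot_comb// is_ subrr mulr0.
Qed.

Lemma bessel F s : uniq s ->
  \sum_(i <- s) normc (L2dot F (e i)) ^+ 2 <= L2norm F ^+ 2.
Proof.
move=> us; rewrite -norm_comb//.
have /L2pythagoras := dot_sub_comb F (fun i => L2dot F (e i)) us.
by rewrite subrK => ->; rewrite lerDr sqr_ge0.
Qed.

Definition enum_upto N : seq I := pmap pickle_inv (iota 0 N).

Lemma uniq_enum_upto N : uniq (enum_upto N).
Proof. by rewrite (pmap_uniq pickle_invK)// iota_uniq. Qed.

Lemma mem_enum_upto N i : (i \in enum_upto N) = (pickle i < N)%N.
Proof.
by rewrite (can2_mem_pmap pickle_invK pickleK_inv) mem_iota.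
Qed.

Lemma enum_uptoD N m : enum_upto (N + m) = enum_upto N ++ pmap pickle_inv (iota N m).
Proof. by rewrite /enum_upto iotaD pmap_cat. Qed.

(** Inner products with a fixed vector pass to norm limits; it is used when they
    are eventually constant, as are Fourier coefficients of partial sums. *)
Lemma L2dot_cvg (S_ : nat -> L2 mu) F G z :
  (forall eps, 0 < eps -> exists N, forall m, (N <= m)%N -> L2norm (F - S_ m) <= eps) ->
  (exists N, forall m, (N <= m)%N -> L2dot (S_ m) G = z) ->
  L2dot F G = z.
Proof.
move=> SF [N1 Sz]; apply/eqP; rewrite -subr_eq0 -normc_eq0; apply/eqP.
apply/eqP; rewrite eq_le normc_ge0 andbT; apply/ler_addgt0Pl => eps eps0.
have p0 : 0 < L2norm G + 1 by rewrite ltr_pwDr ?L2norm_ge0.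
have [N2 hN2] := SF (eps / (L2norm G + 1)) (divr_gt0 eps0 p0).
rewrite addr0 -(Sz (maxn N1 N2)) ?leq_maxl// -L2dotBl.
rewrite (le_trans (L2cauchy_schwarz _ _))//.
apply: le_trans (ler_wpM2r (L2norm_ge0 _) (hN2 _ (leq_maxr _ _))) _.
by rewrite mulrAC ler_pdivrMr// ler_wpM2l ?(ltW eps0)// lerDl.
Qed.

(** The partial sums along an enumeration of the index set form a Cauchy sequence,
    since their squared norms are nondecreasing and bounded. *)
Lemma riesz_fischer a C : 0 <= C ->
  (forall s, uniq s -> \sum_(i <- s) normc (a i) ^+ 2 <= C ^+ 2) ->
  exists G, [/\ L2norm G <= C, forall i, L2dot G (e i) = a i &
    forall eps, 0 < eps -> exists N, forall m, (N <= m)%N ->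
      L2norm (G - comb a (enum_upto m)) <= eps].
Proof.
move=> C0 aC; pose A N := \sum_(i <- enum_upto N) normc (a i) ^+ 2.
have AD N m : L2norm (comb a (enum_upto (N + m)) - comb a (enum_upto N)) ^+ 2 =
    A (N + m)%N - A N.
  rewrite /A enum_uptoD !big_cat /= !(addrC (\sum_(i <- enum_upto N) _)) !addrK.
  by rewrite norm_comb// (pmap_uniq pickle_invK)// iota_uniq.
have ndA : nondecreasing_seq A.
  by move=> N M /subnKC <-; rewrite -subr_ge0 -AD sqr_ge0.
have cA : cvgn A.
  apply: nondecreasing_is_cvgn => //.
  by exists (C ^+ 2) => _ [N _ <-]; exact/aC/uniq_enum_upto.
have [|G HG] := @L2_complete _ _ _ mu (fun N => comb a (enum_upto N)).
  move=> eps eps0.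
  have /cvgrPdist_lt/(_ (eps ^+ 2)) := cA; rewrite exprn_gt0// => /(_ isT).
  case=> N _ hN.
  have key k l : (N <= k)%N -> L2norm (comb a (enum_upto (k + l)) -
      comb a (enum_upto k)) <= eps.
    move=> Nk; rewrite -(@ler_pXn2r _ 2)// ?nnegrE ?L2norm_ge0 ?(ltW eps0)//.
    rewrite AD. apply: (le_trans _ (ltW (hN k Nk))).
    apply: le_trans (ler_norm _); rewrite lerD2r.
    exact: (nondecreasing_cvgn_le ndA).
  exists N => m k Nm Nk; have [/subnKC <-|/ltnW/subnKC <-] := leqP m k.
    by rewrite L2norm_distC key.
  exact: key.
exists G; split => //.
- apply/ler_addgt0Pr => eps eps0; have [N /(_ N (leqnn N)) h] := HG eps eps0.
  have h2 : L2norm (comb a (enum_upto N)) <= C.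
    rewrite -(@ler_pXn2r _ 2)// ?nnegrE ?L2norm_ge0//.
    by rewrite norm_comb ?uniq_enum_upto// aC ?uniq_enum_upto.
  by have := le_trans (ler_L2normD _ _) (lerD h h2); rewrite subrK addrC.
- move=> i; apply: (L2dot_cvg HG); exists (pickle i).+1 => m im.
  by rewrite dot_comb ?uniq_enum_upto// mem_enum_upto im.
Qed.

Hypothesis e_total : forall F, (forall i, L2dot F (e i) = 0) -> F = 0.

Lemma L2_ext F G : (forall i, L2dot F (e i) = L2dot G (e i)) -> F = G.
Proof.
move=> FG; apply/eqP; rewrite -subr_eq0; apply/eqP; apply: e_total => i.
by rewrite L2dotBl FG subrr.
Qed.

Lemma fourier_dense F eps : 0 < eps ->
  exists2 s, uniq s & L2norm (F - comb (fun i => L2dot F (e i)) s) <= eps.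
Proof.
move=> eps0.
have [G [_ GF /(_ _ eps0)[N /(_ N (leqnn N))]]] :=
  riesz_fischer (L2norm_ge0 F) (fun s => @bessel F s).
by rewrite (L2_ext GF) => h; exists (enum_upto N); rewrite ?uniq_enum_upto.
Qed.

Lemma dot_eq0_coef F G :
  (forall i, L2dot F (e i) * conjc (L2dot G (e i)) = 0) -> L2dot F G = 0.
Proof.
move=> FG; apply/eqP; rewrite -normc_eq0 eq_le normc_ge0 andbT.
apply/ler_addgt0Pl => eps eps0; rewrite addr0.
have p0 : 0 < L2norm G + 1 by rewrite ltr_pwDr ?L2norm_ge0.
have [s us hs] := fourier_dense F (divr_gt0 eps0 p0).
have : L2dot (comb (fun i => L2dot F (e i)) s) G = 0.
  rewrite L2dot_suml big1// => i _.
  by rewrite L2dotZl [L2dot (e i) G]L2dotC FG.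
rewrite -[L2dot F G]subr0 => <-; rewrite -L2dotBl.
rewrite (le_trans (L2cauchy_schwarz _ _))//.
apply: le_trans (ler_wpM2r (L2norm_ge0 _) hs) _.
by rewrite mulrAC ler_pdivrMr// ler_wpM2l ?(ltW eps0)// lerDl.
Qed.

(** Multipliers by indicators of index sets, which give all the projections that
    are needed: onto the Hardy space and onto its coordinate pieces. *)
Lemma fourier_mask F (D : pred I) : exists2 G, L2norm G <= L2norm F &
  forall i, L2dot G (e i) = if D i then L2dot F (e i) else 0.
Proof.
have [|G [GF Gi _]] := @riesz_fischer
  (fun i => if D i then L2dot F (e i) else 0) _ (L2norm_ge0 F); last by exists G.
move=> s us; apply: le_trans (bessel F us); apply: ler_sum => i _.
by case: ifP => // _; rewrite normc0 expr0n sqr_ge0.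
Qed.

End OrthonormalFamily.

(** * Fourier series on the torus *)
Section TorusFourier.
Context {R : realType} {n : nat}.
Local Notation RT := (measurableTypeR R).
Local Notation mu := (torus_measure R n).
Local Notation Re := complex.Re.
Local Notation Im := complex.Im.
Implicit Types (F G : L2 mu) (k l : 'I_n -> int).

Definition chi k : L2 mu := L2class (character_fun R k).

Lemma integral_torus1 : (\int[mu]_x 1%:E = 1)%E.
Proof. by rewrite integral_cst// mul1e; exact: probability_setT. Qed.

Lemma integrable_torus1 : mu.-integrable setT (fun=> 1%:E : \bar R).
Proof.
apply/integrableP; split; first exact: measurable_cst.
under eq_integral do rewrite abse1.
by rewrite integral_torus1 ltry.
Qed.

Lemma integrable_cos_phase k c :
  mu.-integrable setT (fun x => (cos (phase k x + c))%:E).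
Proof.
apply: le_integrable integrable_torus1 => //.
  by apply/measurable_EFinP; exact: measurable_cos_phase.
by move=> x _; rewrite abse_EFin lee_fin normr1 cos_max.
Qed.

Lemma integral_cos_phase k c : (exists j, k j != 0) ->
  (\int[mu]_x (cos (phase k x + c))%:E = 0)%E.
Proof.
move=> kj; have := integral_torus_1Dcos c kj.
under eq_integral do rewrite EFinD.
rewrite integralD//; last 2 first.
- exact: integrable_torus1.
- exact: integrable_cos_phase.
rewrite integral_torus1; case: (\int[mu]_x _)%E => [r| |]//= [] /eqP.
by rewrite addrC -subr_eq0 addrK => /eqP ->.
Qed.

Lemma sin_cosE (a : R) : sin a = cos (a - pi / 2).
Proof. by rewrite -sinDpihalf subrK. Qed.

Lemma expi0 : expi (0 : R) = 1.
Proof. by rewrite /expi cos0 sin0. Qed.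

Lemma dot_chi k l : L2dot (chi k) (chi l) =
  cintegral mu (fun x => expi (phase (fun j => k j - l j) x)).
Proof.
rewrite L2dot_class; congr cintegral; apply/funext => x.
rewrite [LHS](_ : _ = expi (phase k x) * conjc (expi (phase l x)))//.
by rewrite conj_expi -expiD phaseD phaseN.
Qed.

Lemma dot_chi_eq k : L2dot (chi k) (chi k) = 1.
Proof.
rewrite dot_chi /cintegral /Rintegral.
have -> : (fun j => k j - k j) = (fun=> 0) by apply/funext => j; rewrite subrr.
under eq_integral do rewrite phase0 /= cos0.
under [in X in _ +i* X]eq_integral do rewrite phase0 /= sin0.
by rewrite integral_torus1 integral0.
Qed.

Lemma dot_chi_neq k l : (exists j, k j != l j) -> L2dot (chi k) (chi l) = 0.
Proof.
move=> [j kl]; have h : exists j, k j - l j != 0 by exists j; rewrite subr_eq0.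
rewrite dot_chi /cintegral /Rintegral.
under eq_integral do rewrite /= -[X in cos X]addr0.
under [in X in _ +i* X]eq_integral do rewrite /= sin_cosE.
by rewrite !integral_cos_phase.
Qed.


Definition cos_fun k (c : R) : L2fun mu :=
  (expi (- c) / 2) *: character_fun R (fun j => - k j) +
  (expi c / 2) *: character_fun R k.

Lemma cos_funE k c x : cos_fun k c x = (cos (phase k x + c))%:C.
Proof.
rewrite [LHS](_ : _ = expi (- c) / 2 * expi (phase (fun j => - k j) x) +
  expi c / 2 * expi (phase k x))//.
rewrite mulrAC -expiD mulrAC -expiD -mulrDl phaseN -opprD addrC (addrC c).
set a := phase k x + c; rewrite /expi cosN sinN.
apply: (@mulIf _ 2); rewrite ?pnatr_eq0// divfK ?pnatr_eq0//.
rewrite mulr_natr mulr2n; apply/eqP; rewrite eq_complex /= eqxx /=.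
by rewrite subrr addr0.
Qed.

(** Both real and imaginary parts of a representative are orthogonal to every
    phase-shifted cosine, by combining the coefficients at [k] and [- k]. *)
Lemma chi_total F : (forall k, fourier_coef F k = 0) -> F = 0.
Proof.
move=> F0; rewrite -[F]L2class_repr; pose u : L2fun mu := repr F.
have E k c x : u x * conjc (cos_fun k c x) =
    (Re (u x) * cos (phase k x + c)) +i* (Im (u x) * cos (phase k x + c)).
  rewrite cos_funE conjc_real; apply/eqP; rewrite eq_complex Defs.ReM Defs.ImM /=.
  by apply/andP; split; apply/eqP; ring.
have i k c : cintegral mu (fun x => u x * conjc (cos_fun k c x)) = 0.
  rewrite -L2dot_class L2class_repr L2classD !L2classZ L2dotDr !L2dotZr.
  by rewrite [X in _ * X + _]F0 [X in _ + _ * X]F0 !mulr0 addr0.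
have ci k c := cintegrable_dot u (cos_fun k c).
have z (f : n.-tuple RT -> R) : mu.-integrable setT (fun x => (f x)%:E) ->
    \int[mu]_x f x = 0 -> (\int[mu]_x (f x)%:E = 0)%E.
  move=> fi f0; rewrite -[LHS]fineK ?integrable_fin_num//.
  by rewrite -[fine _]/(\int[mu]_x f x) f0.
have ae0 (p : R[i] -> R) :
    (forall k c, mu.-integrable setT
       (fun x => (p (u x) * cos (phase k x + c))%:E)) ->
    (forall k c, \int[mu]_x (p (u x) * cos (phase k x + c)) = 0) ->
    {ae mu, forall x, p (u x) = 0}.
  move=> pi_ p0; apply: annihilate_ae_eq0; last by move=> k c; exact: z.
  have := pi_ (fun=> 0) 0; congr (_.-integrable _ _).
  by apply/funext => x; rewrite phase0 addr0 cos0 mulr1.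
have re0 : {ae mu, forall x, Re (u x) = 0}.
  apply: ae0 => k c.
    by case: (ci k c) => h _; apply: eq_integrable h => // x _; rewrite E.
  have [h _] := i k c; rewrite -[RHS]h.
  by apply: eq_Rintegral => x _; rewrite E.
have im0 : {ae mu, forall x, Im (u x) = 0}.
  apply: ae0 => k c.
    by case: (ci k c) => _ h; apply: eq_integrable h => // x _; rewrite E.
  have [_ h] := i k c; rewrite -[RHS]h.
  by apply: eq_Rintegral => x _; rewrite E.
rewrite -L2class0; apply/L2classP; apply: filterS2 re0 im0 => x.
by rewrite -/u; case: (u x) => a b /= -> ->.
Qed.

(** Characters indexed by a countable type, as orthonormal families are; plain
    functions [k] are recovered through [finfun_funK]. *)
Definition chi_ffun (k : {ffun 'I_n -> int}) : L2 mu := chi k.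

Lemma finfun_funK k : (finfun k : 'I_n -> int) = k.
Proof. by apply/funext => j; rewrite ffunE. Qed.

Lemma chi_ffun_orthonormal (k l : {ffun 'I_n -> int}) :
  L2dot (chi_ffun k) (chi_ffun l) = (k == l)%:R.
Proof.
case: eqVneq => [->|kl]; first exact: dot_chi_eq.
apply: dot_chi_neq; apply: contrapT => /forallNP kl'; move/eqP: kl; apply.
by apply/ffunP => j; apply/eqP/negPn/negP; exact: kl'.
Qed.

Lemma chi_ffun_total F :
  (forall k : {ffun 'I_n -> int}, L2dot F (chi_ffun k) = 0) -> F = 0.
Proof.
move=> F0; apply: chi_total => k.
by have := F0 (finfun k); rewrite /chi_ffun finfun_funK.
Qed.

Lemma fourier_ext F G :
  (forall k, fourier_coef F k = fourier_coef G k) -> F = G.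
Proof.
by move=> FG; apply: (L2_ext chi_ffun_total) => k; exact: FG.
Qed.

Lemma dot_eq0_fourier F G :
  (forall k, fourier_coef F k = 0 \/ fourier_coef G k = 0) -> L2dot F G = 0.
Proof.
move=> FG; apply: (dot_eq0_coef chi_ffun_orthonormal chi_ffun_total) => k.
have [h|h] : L2dot F (chi_ffun k) = 0 \/ L2dot G (chi_ffun k) = 0 := FG k.
  by rewrite h mul0r.
by rewrite h conjc0 mulr0.
Qed.

Lemma fourier_restrict F (D : pred ('I_n -> int)) :
  exists2 G, L2norm G <= L2norm F &
    forall k, fourier_coef G k = if D k then fourier_coef F k else 0.
Proof.
have [G GF Gk] := fourier_mask chi_ffun_orthonormal F
  (fun k : {ffun 'I_n -> int} => D k).
exists G => // k.
by have := Gk (finfun k); rewrite /chi_ffun finfun_funK.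
Qed.

End TorusFourier.

(** * Multiplication operators *)
Section Multiplication.
Context d (T : measurableType d) (R : realType).
Variable mu : {measure set T -> \bar R}.
Implicit Types (F G : L2 mu) (phi : Linfty mu).

Lemma L2mulD phi F G : L2mul phi (F + G) = L2mul phi F + L2mul phi G.
Proof.
rewrite -[F]L2class_repr -[G]L2class_repr -L2classD !L2mul_class -L2classD.
congr L2class; apply: val_inj; apply/funext => x; exact: mulrDr.
Qed.

Lemma L2mulZ phi a F : L2mul phi (a *: F) = a *: L2mul phi F.
Proof.
rewrite -[F]L2class_repr -L2classZ !L2mul_class -L2classZ.
congr L2class; apply: val_inj; apply/funext => x; exact: mulrCA.
Qed.

Lemma Linfty_conj_subproof phi : (fun x => conjc (phi x)) \in cLfun mu +oo%E.
Proof.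
have /cLfunP[mphi fphi] := LinftyP phi; apply/cLfunP; split.
  exact: cmeasurable_conj.
rewrite (_ : (fun x => normc (conjc (phi x))) = (fun x => normc (phi x)))//.
by apply/funext => x; rewrite normc_conj.
Qed.

Definition Linfty_conj phi : Linfty mu := MkLinfty (Linfty_conj_subproof phi).

Lemma L2mul_dot phi F G : L2dot (L2mul phi F) G = L2dot F (L2mul (Linfty_conj phi) G).
Proof.
rewrite -[F]L2class_repr -[G]L2class_repr !L2mul_class !L2dot_class.
congr cintegral; apply/funext => x.
rewrite [LHS](_ : _ = phi x * (repr F : L2fun mu) x * conjc ((repr G : L2fun mu) x))//.
rewrite [RHS](_ : _ = (repr F : L2fun mu) x *
  conjc (conjc (phi x) * (repr G : L2fun mu) x))//.
by rewrite conjcM conjcK mulrCA mulrA.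
Qed.

End Multiplication.

Section CharacterMultiplication.
Context {R : realType} {n : nat}.
Local Notation RT := (measurableTypeR R).
Local Notation mu := (torus_measure R n).
Implicit Types (F G : L2 mu) (k l : 'I_n -> int) (i : 'I_n).

Definition chi_Linfty k : Linfty mu :=
  MkLinfty (expi_cLfun mu (ltry 0) (@measurable_phase R n k)).

Definition chi_mul k F := L2mul (chi_Linfty k) F.

Lemma chi_mulD k F G : chi_mul k (F + G) = chi_mul k F + chi_mul k G.
Proof. exact: L2mulD. Qed.

Lemma chi_mulZ k a F : chi_mul k (a *: F) = a *: chi_mul k F.
Proof. exact: L2mulZ. Qed.

Lemma chi_mul_chi_mul k l F : chi_mul k (chi_mul l F) = chi_mul (fun j => k j + l j) F.
Proof.
rewrite /chi_mul -[F]L2class_repr !L2mul_class.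
congr L2class; apply: val_inj; apply/funext => x.
by rewrite /= mulrA -expiD phaseD.
Qed.

Lemma chi_mul0 F : chi_mul (fun=> 0) F = F.
Proof.
rewrite /chi_mul -[F]L2class_repr !L2mul_class.
congr L2class; apply: val_inj; apply/funext => x.
by rewrite /= phase0 expi0 mul1r.
Qed.

Lemma chi_mul_chi k l : chi_mul k (chi l) = chi (fun j => k j + l j).
Proof.
rewrite /chi_mul /chi L2mul_class.
congr L2class; apply: val_inj; apply/funext => x.
by rewrite /= -expiD phaseD.
Qed.

Lemma chi_mul_dot k F G : L2dot (chi_mul k F) (chi_mul k G) = L2dot F G.
Proof.
rewrite /chi_mul -[F]L2class_repr -[G]L2class_repr !L2mul_class !L2dot_class.
congr cintegral; apply/funext => x /=.
rewrite conjcM mulrACA -normc_sqr normc_expi expr1n.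
by rewrite mul1r.
Qed.

Lemma chi_mulNK k F : chi_mul k (chi_mul (fun j => - k j) F) = F.
Proof.
rewrite chi_mul_chi_mul (_ : (fun j => _) = fun=> 0) ?chi_mul0//.
by apply/funext => j; rewrite addrN.
Qed.

Lemma chi_mul_norm k F : L2norm (chi_mul k F) = L2norm F.
Proof.
apply/eqP; rewrite -(@eqrXn2 _ 2) ?L2norm_ge0//.
by apply/eqP/complexI; rewrite -!L2dotFF chi_mul_dot.
Qed.

Lemma fourier_chi_mul k F l :
  fourier_coef (chi_mul k F) l = fourier_coef F (fun j => l j - k j).
Proof.
rewrite -[RHS](chi_mul_dot k) chi_mul_chi; congr (L2dot _ (chi _)).
by apply/funext => j; rewrite addrC subrK.
Qed.

Definition unit_index i : 'I_n -> int := fun j => (j == i)%:Z.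

Lemma coord_chi_mul i F : L2mul (Defs.coord R i) F = chi_mul (unit_index i) F.
Proof.
rewrite /chi_mul -[F]L2class_repr !L2mul_class.
congr L2class; apply: val_inj; apply/funext => x /=; congr (expi _ * _).
rewrite /phase (bigD1 i)//= /unit_index eqxx mul1r big1 ?addr0//.
by move=> j /negPf ->; rewrite mul0r.
Qed.

End CharacterMultiplication.

(** * Projection, shifts and their adjoints on the Hardy space *)
Section HardySpace.
Context {R : realType} {n : nat}.
Local Notation mu := (torus_measure R n).
Local Notation H2 := (H2 R n).
Implicit Types (F G u : L2 mu) (f g h : H2) (k l : 'I_n -> int) (i j : 'I_n).
Implicit Types (S : H2 -> H2).

Definition nonneg_index k := [forall j, 0 <= k j].

Lemma hardy_coef f k : ~~ nonneg_index k -> fourier_coef f k = 0.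
Proof.
rewrite negb_forall => /existsP[j]; rewrite -ltNge => kj.
by apply: (hardyP _ (H2P f)); exists j.
Qed.

Lemma hardy_of_coef F :
  (forall k, ~~ nonneg_index k -> fourier_coef F k = 0) -> F \in @hardy R n.
Proof.
move=> F0; apply/hardyP => k [j kj]; apply: F0.
by rewrite negb_forall; apply/existsP; exists j; rewrite -ltNge.
Qed.

Lemma chi_hardy k : nonneg_index k -> chi k \in @hardy R n.
Proof.
move=> k0; apply: hardy_of_coef => l l0; apply: dot_chi_neq.
apply: contrapT => /forallNP kl; move: l0; rewrite (_ : l = k) ?k0//.
by apply/funext => j; apply/eqP; rewrite eq_sym; apply/negPn/negP; exact: kl.
Qed.

Lemma H2_inj : injective (@H2_val R n).
Proof. exact: val_inj. Qed.

Lemma H2_valD f g : H2_val (f + g) = H2_val f + H2_val g.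
Proof. by []. Qed.

Lemma H2_valZ (a : R[i]) f : H2_val (a *: f) = a *: H2_val f.
Proof. by []. Qed.

Lemma H2_valB f g : H2_val (f - g) = H2_val f - H2_val g.
Proof. by []. Qed.

Lemma H2_val_sum (I : Type) (r : seq I) (P : pred I) (f : I -> H2) :
  H2_val (\sum_(i <- r | P i) f i) = \sum_(i <- r | P i) H2_val (f i).
Proof. by apply: (big_morph (@H2_val R n)). Qed.

Lemma H2_normE f : `|f| = (L2norm f)%:C.
Proof. by []. Qed.

Lemma hardy_restrict F (D : pred ('I_n -> int)) :
  exists2 h : H2, L2norm h <= L2norm F &
    forall k, fourier_coef h k =
      if nonneg_index k && D k then fourier_coef F k else 0.
Proof.
have [G GF Gk] := fourier_restrict F (fun k => nonneg_index k && D k).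
have Gh : G \in @hardy R n.
  by apply: hardy_of_coef => k /negPf k0; rewrite Gk k0.
by exists (MkH2 Gh).
Qed.

Lemma dotB_eq0 (F G H : L2 mu) : L2dot (F - G) H = 0 -> L2dot F H = L2dot G H.
Proof. by rewrite L2dotBl => /eqP; rewrite subr_eq0 => /eqP. Qed.

Lemma hardy_ext f g : (forall h, L2dot f h = L2dot g h) -> f = g.
Proof.
move=> fg; apply/eqP; rewrite -subr_eq0; apply/eqP.
have z h : L2dot (H2_val (f - g)) h = 0 by rewrite H2_valB L2dotBl fg subrr.
apply: val_inj; apply: L2norm_eq0; apply/eqP; rewrite -sqrf_eq0.
by apply/eqP/complexI; rewrite -L2dotFF; exact: z.
Qed.

(** The projection exists because truncating the Fourier coefficients to
    nonnegative indices gives an element of the Hardy space, whose difference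
    with [u] has no coefficient in common with it. *)
Lemma hardy_proj_dot u g : L2dot (hardy_proj u) g = L2dot u g.
Proof.
suff : [set h : H2 | forall g : H2, L2dot (u - H2_val h) g = 0] (hardy_proj u).
  by move=> /(_ g)/dotB_eq0 ->.
apply: xgetPex; have [h _ hk] := hardy_restrict u xpredT.
exists h => g'; apply: dot_eq0_fourier => k.
case: (boolP (nonneg_index k)) => k0; last by right; exact: hardy_coef.
left; rewrite /fourier_coef L2dotBl.
by have := hk k; rewrite k0 /= /fourier_coef => ->; rewrite subrr.
Qed.

Lemma hardy_projE u h : (forall g, L2dot u g = L2dot h g) -> hardy_proj u = h.
Proof.
by move=> uh; apply: hardy_ext => g; rewrite hardy_proj_dot.
Qed.

Lemma Tz_val i f : H2_val (Tz i f) = chi_mul (unit_index i) f.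
Proof. exact: coord_chi_mul. Qed.

Lemma iter_Tz_val i m f :
  H2_val (iter m (Tz i) f) = chi_mul (fun j => unit_index i j *+ m) f.
Proof.
elim: m => [|m ih] /=.
  by rewrite -[LHS]chi_mul0; congr chi_mul; apply/funext => j; rewrite mulr0n.
rewrite coord_chi_mul ih chi_mul_chi_mul; congr chi_mul; apply/funext => j.
by rewrite mulrS.
Qed.

Lemma iter_Tz_norm i m f : L2norm (iter m (Tz i) f) = L2norm f.
Proof. by rewrite iter_Tz_val chi_mul_norm. Qed.

Lemma fourier_iter_Tz i m f k : fourier_coef (iter m (Tz i) f) k =
  fourier_coef f (fun j => k j - unit_index i j *+ m).
Proof. by rewrite iter_Tz_val fourier_chi_mul. Qed.

(** The adjoint of the shift multiplies by the conjugate coordinate and projects;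
    exhibiting this value shows that the one chosen in the definition of the
    adjoint satisfies its specification. *)
Lemma adjoint_Tz_dot i f g : L2dot (Tz i g) f = L2dot g (adjoint (Tz i) f).
Proof.
suff : [set h : H2 | forall g : H2, L2dot (Tz i g) f = L2dot g h]
  (adjoint (Tz i) f) by apply.
apply: xgetPex.
exists (hardy_proj (chi_mul (fun j => - unit_index i j) f)) => g'.
rewrite [RHS]L2dotC hardy_proj_dot -L2dotC Tz_val.
by rewrite -[in RHS](chi_mul_dot (unit_index i)) chi_mulNK.
Qed.

Definition Tz_adj i m f := iter m (adjoint (Tz i)) f.

Lemma Tz_adj_dot i m f g : L2dot (iter m (Tz i) g) f = L2dot g (Tz_adj i m f).
Proof.
elim: m g f => [//|m ih] g f.
by rewrite [iter _ _ g]/(Tz i (iter m (Tz i) g)) adjoint_Tz_dot ih /Tz_adj -iterSr.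
Qed.

Lemma hardy_extr f g : (forall h, L2dot h f = L2dot h g) -> f = g.
Proof. by move=> fg; apply: hardy_ext => h; rewrite [LHS]L2dotC fg -L2dotC. Qed.

Lemma Tz_adj_linear i m (a : R[i]) f g :
  Tz_adj i m (a *: f + g) = a *: Tz_adj i m f + Tz_adj i m g.
Proof.
apply: hardy_extr => h; rewrite -Tz_adj_dot !H2_valD !H2_valZ.
by rewrite !L2dotDr !L2dotZr -!Tz_adj_dot.
Qed.

Lemma Tz_adjD i m f g : Tz_adj i m (f + g) = Tz_adj i m f + Tz_adj i m g.
Proof. by rewrite -[f]scale1r Tz_adj_linear !scale1r. Qed.

Lemma Tz_adj0 i m : Tz_adj i m 0 = 0.
Proof. by have := Tz_adj_linear i m (-1) 0 0; rewrite !scaleN1r !addNr. Qed.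

Lemma Tz_adj_norm i m f : L2norm (Tz_adj i m f) <= L2norm f.
Proof.
apply: L2norm_le_dot; first exact: L2norm_ge0.
rewrite -Tz_adj_dot mulrC -(iter_Tz_norm i m (Tz_adj i m f)).
exact: L2cauchy_schwarz.
Qed.

Lemma bounded_opP S : bounded_op S <->
  exists2 M, 0 <= M & forall f, L2norm (S f) <= M * L2norm f.
Proof.
split=> [[M SM]|[M _ SM]]; last first.
  by exists M => f; rewrite !H2_normE -rmorphM lecR.
exists `|M| => // f; have := SM f; rewrite !H2_normE -rmorphM lecR.
by move=> /le_trans; apply; rewrite ler_wpM2r ?L2norm_ge0// ler_norm.
Qed.

Lemma le1_H2_norm f : (`|f| <= 1) = (L2norm f <= 1).
Proof. by rewrite H2_normE -lecR. Qed.

Lemma opnorm_le S (c : R) : (forall f, L2norm f <= 1 -> L2norm (S f) <= c) ->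
  (opnorm S <= c%:E)%E.
Proof.
move=> Sc; apply: ge_ereal_sup => _ [f /= f1 <-].
by rewrite lee_fin Sc// -le1_H2_norm.
Qed.

Lemma opnorm_ge S f : L2norm f <= 1 -> ((L2norm (S f))%:E <= opnorm S)%E.
Proof.
by move=> f1; apply: ereal_sup_ubound; exists f => //=; rewrite le1_H2_norm.
Qed.

Lemma opnorm_ge0 S : (0 <= opnorm S)%E.
Proof.
apply: (le_trans _ (@opnorm_ge S 0 _)); first by rewrite lee_fin L2norm_ge0.
by rewrite [L2norm _]L2norm0.
Qed.

(** Uniform convergence on the unit ball, in the form in which all limits of
    operators are handled below. *)
Lemma opnorm_cvg0 (S_ : nat -> H2 -> H2) :
  (fun m => opnorm (S_ m)) @ \oo --> 0%E <->
  (forall eps : R, 0 < eps -> exists N, forall m, (N <= m)%N ->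
    forall f, L2norm f <= 1 -> L2norm (S_ m f) <= eps).
Proof.
split=> [/fine_cvgP[[N1 _ hN1] /cvgrPdist_le h] eps eps0|h].
  have [N2 _ hN2] := h eps eps0.
  exists (maxn N1 N2) => m; rewrite geq_max => /andP[m1 m2] f f1.
  have := hN2 m m2; rewrite /= sub0r normrN => /(le_trans (ler_norm _)).
  rewrite -lee_fin fineK; last exact: hN1 m m1.
  rewrite -lee_fin; apply: le_trans; exact: opnorm_ge.
have hf : forall eps : R, 0 < eps -> \forall m \near \oo, (opnorm (S_ m) <= eps%:E)%E.
  move=> eps eps0; have [N hN] := h eps eps0.
  by exists N => // m Nm; apply: opnorm_le; exact: hN.
apply/fine_cvgP; split.
  apply: filterS (hf 1 ltr01) => m le1.
  by rewrite ge0_fin_numE ?opnorm_ge0// (le_lt_trans le1)// ltry.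
apply/cvgrPdist_le => eps eps0; apply: filterS (hf eps eps0) => m le1.
have fn : opnorm (S_ m) \is a fin_num.
  by rewrite ge0_fin_numE ?opnorm_ge0// (le_lt_trans le1)// ltry.
rewrite /= sub0r normrN ger0_norm ?fine_ge0 ?opnorm_ge0//.
by rewrite -lee_fin fineK.
Qed.

Lemma unit_ball_bound S (c : R) : (forall (a : R[i]) f, S (a *: f) = a *: S f) ->
  0 <= c -> (forall f, L2norm f <= 1 -> L2norm (S f) <= c) ->
  forall f, L2norm (S f) <= c * L2norm f.
Proof.
move=> SZ c0 Sc f; have [f0|f0] := eqVneq (L2norm f) 0.
  have -> : f = 0 by apply: val_inj; exact: L2norm_eq0.
  have := SZ 0 0; rewrite !scale0r => ->.
  by rewrite [X in X <= _]L2norm0 mulr_ge0// L2norm_ge0.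
have fp : 0 < L2norm f by rewrite lt_def f0 L2norm_ge0.
have := Sc ((L2norm f)^-1%:C *: f); rewrite SZ !H2_valZ !L2normZ normc_real.
rewrite ger0_norm ?invr_ge0 ?L2norm_ge0// mulVf// => /(_ (lexx _)).
by rewrite mulrC ler_pdivrMr.
Qed.

End HardySpace.

(** * Monomials in the Hardy space *)
Section HardyCharacters.
Context {R : realType} {n : nat}.
Local Notation mu := (torus_measure R n).
Local Notation H2 := (H2 R n).
Implicit Types (F G u : L2 mu) (f g h : H2) (k l p q : 'I_n -> int) (i j : 'I_n).

(** Monomials, extended by [0] to indices outside the Hardy space so that sums
    over arbitrary indices can be written without proofs of membership. *)
Definition hardy_chi k : H2 := insubd (0 : H2) (chi k).

Lemma hardy_chiE k : nonneg_index k -> H2_val (hardy_chi k) = chi k.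
Proof. by move=> k0; rewrite val_insubd chi_hardy. Qed.

Lemma norm_hardy_chi k : nonneg_index k -> L2norm (hardy_chi k) = 1.
Proof.
move=> k0; apply/eqP; rewrite hardy_chiE// -(@eqrXn2 _ 2) ?L2norm_ge0//.
by apply/eqP/complexI; rewrite -L2dotFF dot_chi_eq expr1n.
Qed.

(** Density of polynomials: a property stable under linear combinations and norm
    limits holds everywhere once it holds for monomials. *)
Lemma hardy_linear_closed_ind (P : H2 -> Prop) :
  (forall k, nonneg_index k -> P (hardy_chi k)) -> P 0 ->
  (forall (c : R[i]) f g, P f -> P g -> P (c *: f + g)) ->
  (forall f, (forall eps, 0 < eps -> exists2 g, P g & L2norm (f - g) <= eps) -> P f) ->
  forall f, P f.
Proof.
move=> Pchi P0 PD Pcl f; apply: Pcl => eps eps0.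
have [s us hs] := fourier_dense (@chi_ffun_orthonormal R n)
  (@chi_ffun_total R n) (H2_val f) eps0.
exists (\sum_(k <- s | nonneg_index k) fourier_coef f k *: hardy_chi k).
  by elim/big_rec : _ => // k g k0 Pg; exact/PD/Pg/Pchi.
apply: le_trans hs; rewrite le_eqVlt; apply/orP; left; apply/eqP.
rewrite H2_valB H2_val_sum big_mkcond; congr (L2norm (_ - _)); apply: eq_bigr => k _.
case: ifPn => k0; first by rewrite H2_valZ hardy_chiE.
by rewrite [L2dot _ _](hardy_coef f k0) scale0r.
Qed.

Lemma hardy_dot_eq0 F g :
  (forall k, nonneg_index k -> fourier_coef F k = 0) -> L2dot F g = 0.
Proof.
move=> F0; apply: dot_eq0_fourier => k.
by case: (boolP (nonneg_index k)) => k0; [left; exact: F0|right; exact: hardy_coef].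
Qed.

(** Multiplication by a monomial as a composition of powers of coordinate shifts,
    which transports the invariance under each shift. *)
Definition multi_shift (p : 'I_n -> nat) (r : seq 'I_n) f :=
  foldr (fun i => iter (p i) (Tz i)) f r.

Lemma multi_shift_val (p : 'I_n -> nat) r f : H2_val (multi_shift p r f) =
  chi_mul (fun j => \sum_(i <- r) unit_index i j *+ p i) f.
Proof.
elim: r => [|i r ih] /=.
  by rewrite -[LHS]chi_mul0; congr chi_mul; apply/funext => j; rewrite big_nil.
rewrite iter_Tz_val ih chi_mul_chi_mul; congr chi_mul; apply/funext => j.
by rewrite big_cons.
Qed.

Lemma multi_shift_enum_val (p : 'I_n -> nat) f :
  H2_val (multi_shift p (enum 'I_n) f) = chi_mul (fun j => (p j)%:Z) f.
Proof.
rewrite multi_shift_val; congr chi_mul; apply/funext => j.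
rewrite big_enum /= (bigD1 j)//= /unit_index eqxx big1 ?addr0 ?natz// => i ij.
by rewrite eq_sym (negPf ij) mul0rn.
Qed.

(** Finitely many frequencies are all moved into the Hardy space by a large power
    of the product of the coordinates. *)
Lemma index_lower_bound (s : seq {ffun 'I_n -> int}) :
  exists m : nat, forall k : {ffun 'I_n -> int}, k \in s ->
    nonneg_index (fun j => k j + m%:Z).
Proof.
exists (\sum_(k <- s) \sum_j `|k j|)%N => k ks; apply/forallP => j.
rewrite (big_rem k)//= (bigD1 j)//=; lia.
Qed.

End HardyCharacters.

(** * The symbol of a shift-invariant operator *)
Section ToeplitzSymbol.
Context {R : realType} {n : nat}.
Local Notation mu := (torus_measure R n).
Local Notation H2 := (H2 R n).
Implicit Types (F G u : L2 mu) (f g h : H2) (k l p q : 'I_n -> int) (i j : 'I_n).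
Variable A : {linear H2 -> H2}.
Hypothesis A_shift : forall i f g, L2dot (A (Tz i f)) (Tz i g) = L2dot (A f) g.

Lemma matrix_coef_multi_shift p f g f' g' : nonneg_index p ->
  H2_val f' = chi_mul p f -> H2_val g' = chi_mul p g ->
  L2dot (A f') g' = L2dot (A f) g.
Proof.
move=> /forallP p0 ff' gg'; pose P j := `|p j|%N.
have pP : p = (fun j => (P j)%:Z) by apply/funext => j; rewrite /P gez0_abs.
have -> : f' = multi_shift P (enum 'I_n) f.
  by apply: H2_inj; rewrite multi_shift_enum_val -pP.
have -> : g' = multi_shift P (enum 'I_n) g.
  by apply: H2_inj; rewrite multi_shift_enum_val -pP.
elim: (enum 'I_n) => [//|i r ih] /=.
by elim: (P i) => [//|m ihm]; rewrite A_shift.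
Qed.

(** The entry at a frequency [k], read at the smallest pair of monomials with
    difference [k]: the negative and the positive part of [k]. *)
Definition symbol_coef k : R[i] :=
  L2dot (A (hardy_chi (fun j => Num.max (- k j) 0)))
        (hardy_chi (fun j => Num.max (k j) 0)).

(** The matrix of [A] is constant along diagonals: both pairs of monomials with the
    same difference are reached from a common pair by a shift, the exponent of
    which is the minimum of [p] and [q]. *)
Lemma symbol_coefE p q : nonneg_index p -> nonneg_index q ->
  L2dot (A (hardy_chi p)) (hardy_chi q) = symbol_coef (fun j => q j - p j).
Proof.
move=> p0 q0; apply: (@matrix_coef_multi_shift (fun j => Num.min (p j) (q j))).
- apply/forallP => j.
  by rewrite le_min (forallP p0 j) (forallP q0 j).
- rewrite !hardy_chiE//.
    by rewrite chi_mul_chi; congr chi; apply/funext => j; lia.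
  by apply/forallP => j; rewrite le_max lexx orbT.
- rewrite !hardy_chiE//.
    by rewrite chi_mul_chi; congr chi; apply/funext => j; lia.
  by apply/forallP => j; rewrite le_max lexx orbT.
Qed.

Local Notation shift_index k m := (fun j => k j + Posz m).

Lemma symbol_coef_shift k m : nonneg_index (shift_index k m) ->
  symbol_coef k =
  L2dot (A (hardy_chi (fun=> Posz m))) (hardy_chi (shift_index k m)).
Proof.
move=> km; have m0 : nonneg_index (fun _ : 'I_n => Posz m) by apply/forallP.
rewrite (symbol_coefE m0 km); congr symbol_coef.
by apply/funext => j; rewrite addrK.
Qed.

Variable M : R.
Hypothesis M0 : 0 <= M.
Hypothesis AM : forall f, L2norm (A f) <= M * L2norm f.

(** The coefficients in a finite set [s] are Fourier coefficients of the single
    function [B], the image under [A] of a high monomial translated back, whose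
    norm is at most [M]; Bessel's inequality then bounds their squares. *)
Lemma symbol_exists : exists F : L2 mu, forall k, fourier_coef F k = symbol_coef k.
Proof.
have [|F [_ Fk _]] := @riesz_fischer _ _ _ _ _ _ (@chi_ffun_orthonormal R n)
  (fun k : {ffun 'I_n -> int} => symbol_coef k) M M0; last first.
  by exists F => k; have := Fk (finfun k); rewrite /chi_ffun finfun_funK.
move=> s us; have [m hm] := index_lower_bound s.
have m0 : nonneg_index (fun _ : 'I_n => Posz m) by apply/forallP.
pose B := chi_mul (fun=> - Posz m) (A (hardy_chi (fun=> Posz m))).
apply: (@le_trans _ _ (L2norm B ^+ 2)); last first.
  rewrite lerXn2r ?nnegrE ?L2norm_ge0// chi_mul_norm (le_trans (AM _))//.
  by rewrite norm_hardy_chi// mulr1.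
apply: le_trans (bessel (@chi_ffun_orthonormal R n) B us).
rewrite big_seq [leRHS]big_seq; apply: ler_sum => k ks.
rewrite (symbol_coef_shift (hm k ks)) -[L2dot B _](chi_mul_dot (fun=> Posz m)).
rewrite [chi_mul _ B](chi_mulNK (fun=> Posz m)).
have -> : chi_mul (fun=> Posz m) (chi_ffun k) =
    H2_val (hardy_chi (shift_index k m)) :> L2 mu.
  rewrite (hardy_chiE (hm k ks)) chi_mul_chi; congr chi.
  by apply/funext => j; rewrite addrC.
exact: lexx.
Qed.

Variable Phi : L2 mu.
Hypothesis PhiE : forall k, fourier_coef Phi k = symbol_coef k.

Lemma dot_shift_symbol k l :
  L2dot (chi_mul k Phi) (chi l) = symbol_coef (fun j => l j - k j).
Proof. by rewrite -[LHS]/(fourier_coef _ l) fourier_chi_mul PhiE. Qed.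

(** After multiplication by a high monomial, two trigonometric polynomials lie in
    the Hardy space, where the form defined by [Phi] is that of [A]. *)
Lemma symbol_sesquilinear_bound (c e : {ffun 'I_n -> int} -> R[i])
    (s t : seq {ffun 'I_n -> int}) :
  normc (L2dot (\sum_(k <- s) c k *: chi_mul k Phi) (\sum_(l <- t) e l *: chi l))
  <= M * L2norm (\sum_(k <- s) c k *: chi k : L2 mu)
       * L2norm (\sum_(l <- t) e l *: chi l : L2 mu).
Proof.
have [m hm] := index_lower_bound (s ++ t).
have hs (k : {ffun 'I_n -> int}) : k \in s -> nonneg_index (shift_index k m).
  by move=> ks; apply: hm; rewrite mem_cat ks.
have ht (k : {ffun 'I_n -> int}) : k \in t -> nonneg_index (shift_index k m).
  by move=> ks; apply: hm; rewrite mem_cat ks orbT.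
pose P (b : {ffun 'I_n -> int} -> R[i]) (r : seq {ffun 'I_n -> int}) : H2 :=
  \sum_(k <- r) b k *: hardy_chi (shift_index k m).
have PE b r : (forall k : {ffun 'I_n -> int}, k \in r ->
      nonneg_index (shift_index k m)) ->
    L2norm (P b r) = L2norm (\sum_(k <- r) b k *: chi k : L2 mu).
  move=> hr; rewrite -[RHS](chi_mul_norm (fun=> Posz m)); congr L2norm.
  rewrite /P H2_val_sum (big_morph _ (chi_mulD _) (id1 := 0)); last first.
    by rewrite -(scale0r (0 : L2 mu)) chi_mulZ !scale0r.
  apply: eq_big_seq => k kr.
  rewrite H2_valZ hardy_chiE ?hr// chi_mulZ chi_mul_chi; congr (_ *: chi _).
  by apply/funext => j; rewrite addrC.
rewrite -(PE c s hs) -(PE e t ht).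
apply: le_trans (ler_wpM2r (L2norm_ge0 _) (AM (P c s))).
apply: le_trans (L2cauchy_schwarz _ _).
rewrite le_eqVlt; apply/orP; left; apply/eqP; congr normc.
rewrite /P linear_sum !H2_val_sum !L2dot_suml.
apply: eq_big_seq => k ks; rewrite linearZ H2_valZ !L2dotZl; congr (_ * _).
rewrite !L2dot_sumr; apply: eq_big_seq => l lt.
rewrite H2_valZ !L2dotZr; congr (_ * _).
rewrite dot_shift_symbol (symbol_coefE (hs k ks) (ht l lt)); congr symbol_coef.
by apply/funext => j; rewrite opprD addrACA subrr addr0.
Qed.

End ToeplitzSymbol.

Section ConjugateClass.
Context d (T : measurableType d) (R : realType).
Variable mu : {measure set T -> \bar R}.
Implicit Types (F G : L2 mu) (phi : Linfty mu).

Lemma L2fun_conj_subproof (u : L2fun mu) : (fun x => conjc (u x)) \in cLfun mu 2%:E.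
Proof.
apply: (@cLfun2_ae_le _ _ _ _ _ (fun x => normc (u x))).
- exact/cmeasurable_conj/L2fun_cmeasurable.
- exact/cLfun_Lfun/L2funP.
- by apply: nearW => x; rewrite normc_conj ger0_norm ?normc_ge0.
Qed.

Definition L2conj F : L2 mu := L2class (MkL2fun (L2fun_conj_subproof (repr F))).

Lemma bounded_Linfty (f : T -> R[i]) (B : R) : cmeasurable f ->
  {ae mu, forall x, normc (f x) <= B} -> f \in cLfun mu +oo%E.
Proof.
move=> mf fB; apply/cLfunP; split => //.
rewrite /finite_norm unlock; case: ifPn => // _.
apply: (@le_lt_trans _ _ B%:E); last exact: ltry.
apply/ess_supP; apply: filterS fB => x /=.
by rewrite lee_fin ger0_norm ?normc_ge0.
Qed.

Lemma L2norm_comb_le (I : countType) (e : I -> L2 mu) :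
  (forall i j, L2dot (e i) (e j) = (i == j)%:R) -> forall F s, uniq s ->
  L2norm (\sum_(i <- s) L2dot F (e i) *: e i) <= L2norm F.
Proof.
move=> e1 F s us.
rewrite -(@ler_pXn2r _ 2)// ?nnegrE ?L2norm_ge0//.
by rewrite norm_comb// bessel.
Qed.

End ConjugateClass.

(** * Boundedness of the symbol *)
Section SymbolBounded.
Context {R : realType} {n : nat}.
Local Notation mu := (torus_measure R n).
Implicit Types (F G u : L2 mu) (k l p q : 'I_n -> int) (i j : 'I_n).
Variables (Phi : L2 mu) (M : R).
Hypothesis M0 : 0 <= M.
Hypothesis Phi_bound : forall (c e : {ffun 'I_n -> int} -> R[i])
    (s t : seq {ffun 'I_n -> int}),
  normc (L2dot (\sum_(k <- s) c k *: chi_mul k Phi) (\sum_(l <- t) e l *: chi l))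
  <= M * L2norm (\sum_(k <- s) c k *: chi k : L2 mu)
       * L2norm (\sum_(l <- t) e l *: chi l : L2 mu).

Lemma dot_Linfty_mul (g : Linfty mu) l : L2dot (L2mul g Phi) (chi l) =
  L2dot (L2mul g (chi (fun=> 0))) (chi_mul l (L2conj Phi)).
Proof.
rewrite -[in LHS](L2class_repr Phi) /chi_mul /chi !L2mul_class !L2dot_class.
congr cintegral; apply/funext => x /=.
by rewrite conjcM conjcK phase0 expi0 mulr1 -mulrA [conjc _ * _]mulrC.
Qed.

Lemma dot_chi_mul_conj k l :
  L2dot (chi k) (chi_mul l (L2conj Phi)) = L2dot (chi_mul k Phi) (chi l).
Proof.
rewrite -[in RHS](L2class_repr Phi) /chi_mul /chi !L2mul_class !L2dot_class.
congr cintegral; apply/funext => x /=.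
by rewrite conjcM conjcK -mulrA [conjc _ * _]mulrC.
Qed.

(** The bounded function [g] is approximated in mean by trigonometric polynomials;
    the bound of [Phi_bound] passes to the limit since the other factor is a
    fixed trigonometric polynomial. *)
Lemma dot_symbol_mul_bound (g : Linfty mu) (e : {ffun 'I_n -> int} -> R[i])
    (t : seq {ffun 'I_n -> int}) :
  normc (L2dot (L2mul g Phi) (\sum_(l <- t) e l *: chi l)) <=
  M * L2norm (L2mul g (chi (fun=> 0))) * L2norm (\sum_(l <- t) e l *: chi l : L2 mu).
Proof.
pose G := L2mul g (chi (fun=> 0)).
pose Q : L2 mu := \sum_(l <- t) e l *: chi l.
pose Y : L2 mu := \sum_(l <- t) e l *: chi_mul l (L2conj Phi).
have -> : L2dot (L2mul g Phi) (\sum_(l <- t) e l *: chi l) = L2dot G Y.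
  rewrite !L2dot_sumr; apply: eq_bigr => l _.
  by rewrite !L2dotZr dot_Linfty_mul.
rewrite -/G -/Q; apply/ler_addgt0Pr => eps eps0.
have p0 : 0 < L2norm Y + 1 by rewrite ltr_pwDr ?L2norm_ge0.
have [s us hs] := fourier_dense (@chi_ffun_orthonormal R n)
  (@chi_ffun_total R n) G (divr_gt0 eps0 p0).
have := L2norm_comb_le (@chi_ffun_orthonormal R n) G us.
set P := (\sum_(i <- s) _) in hs * => PG.
have PY : L2dot P Y =
    L2dot (\sum_(k <- s) L2dot G (chi_ffun k) *: chi_mul k Phi) Q.
  rewrite !L2dot_suml; apply: eq_bigr => k _; rewrite !L2dotZl; congr (_ * _).
  rewrite !L2dot_sumr; apply: eq_bigr => l _; rewrite !L2dotZr; congr (_ * _).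
  exact: dot_chi_mul_conj.
rewrite -[G](subrK P) L2dotDl (le_trans (le_normcD _ _))// addrC lerD//.
  rewrite subrK PY (le_trans (Phi_bound _ _ _ _))// -/Q.
  by rewrite ler_wpM2r ?L2norm_ge0// ler_wpM2l.
rewrite (le_trans (L2cauchy_schwarz _ _))//.
apply: le_trans (ler_wpM2r (L2norm_ge0 _) hs) _.
by rewrite mulrAC ler_pdivrMr// ler_wpM2l ?(ltW eps0)// lerDl.
Qed.

(** The product [L2mul g Phi] is tested against its own Fourier partial sums. *)
Lemma symbol_mul_bound (g : Linfty mu) :
  L2norm (L2mul g Phi) <= M * L2norm (L2mul g (chi (fun=> 0))).
Proof.
apply/ler_addgt0Pr => eps eps0.
have [s us] := fourier_dense (@chi_ffun_orthonormal R n)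
  (@chi_ffun_total R n) (L2mul g Phi) eps0.
have := dot_sub_comb (@chi_ffun_orthonormal R n) (L2mul g Phi)
  (fun k : {ffun 'I_n -> int} => L2dot (L2mul g Phi) (chi_ffun k)) us.
set Q := (\sum_(i <- s) _) => /dotB_eq0 QQ hs.
have QM : L2norm Q <= M * L2norm (L2mul g (chi (fun=> 0))).
  apply: L2norm_le_dot; first by rewrite mulr_ge0 ?L2norm_ge0.
  by rewrite -QQ; exact: dot_symbol_mul_bound.
by have := le_trans (ler_L2normD _ _) (lerD hs QM); rewrite subrK addrC.
Qed.

(** On the set [E] where [Phi] exceeds [M], the bound of [symbol_mul_bound] for
    the indicator of [E] says that the integral of [|Phi|^2 - M^2] is at most
    [0], although it is positive there; so [E] is null. *)
Lemma symbol_ae_bounded :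
  {ae mu, forall x, normc ((repr Phi : L2fun mu) x) <= M}.
Proof.
pose w : L2fun mu := repr Phi; rewrite -/w.
have mw : measurable_fun setT (fun x => normc (w x)).
  exact/cmeasurable_normc/L2fun_cmeasurable.
pose E := [set x | M < normc (w x)].
have mE : measurable E.
  by rewrite -[E]setTI; apply: (measurable_fun_ltr (measurable_cst M) mw).
have gL : (fun x => (\1_E x)%:C) \in cLfun mu +oo%E.
  apply: (@bounded_Linfty _ _ _ _ _ 1).
    by split => /=; [exact: measurable_indic|exact: measurable_cst].
  apply: nearW => x; rewrite normc_real indicE.
  by case: (x \in E); rewrite ?normr1 ?normr0.
have := symbol_mul_bound (MkLinfty gL).
rewrite -(@ler_pXn2r _ 2)// ?nnegrE ?mulr_ge0 ?L2norm_ge0// exprMn.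
rewrite -lee_fin [(M ^+ 2 * _)%:E]EFinM -[Phi]L2class_repr -/w /chi !L2mul_class.
rewrite !L2norm_sqr_class.
have mind : measurable_fun setT (fun x => (\1_E x : R)) by exact: measurable_indic.
have e1 x : normc (L2mulfun (MkLinfty gL) w x) ^+ 2 = \1_E x * normc (w x) ^+ 2.
  rewrite /= normcM normc_real exprMn indicE.
  by case: (x \in E); rewrite ?normr1 ?normr0 ?expr1n ?expr0n ?mul1r ?mul0r.
have e2 x : normc (L2mulfun (MkLinfty gL) (character_fun R (fun=> 0)) x) ^+ 2 =
    \1_E x.
  rewrite [X in normc X](_ : _ = (\1_E x)%:C * expi (phase (fun=> 0) x))//.
  rewrite normcM normc_real exprMn indicE normc_expi expr1n mulr1.
  by case: (x \in E); rewrite ?normr1 ?normr0 ?expr1n ?expr0n.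
under eq_integral do rewrite e1.
under [in X in (_ <= X)%E]eq_integral do rewrite e2.
move=> le1.
have iE : mu.-integrable setT (fun x => ((\1_E x : R))%:E).
  apply: le_integrable (@integrable_torus1 R n) => //.
    exact/measurable_EFinP.
  move=> x _; rewrite abse_EFin lee_fin normr1 indicE.
  by case: (x \in E); rewrite ?normr1 ?normr0.
pose D x := \1_E x * (normc (w x) ^+ 2 - M ^+ 2).
have D0 x : 0 <= D x.
  rewrite /D indicE; case: (boolP (x \in E)) => xE; last by rewrite mul0r.
  rewrite mul1r subr_ge0 lerXn2r ?nnegrE ?normc_ge0//.
  by apply: ltW; move/set_mem: xE.
have mD : measurable_fun setT D.
  apply: measurable_funM => //; apply: measurable_funB => //.
  exact: measurable_funX.
have ID : (\int[mu]_x (D x)%:E = 0)%E.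
  have iM : mu.-integrable setT (fun x => ((M ^+ 2)%:E * (\1_E x)%:E)%E).
    exact: integrableZl.
  apply/eqP; rewrite eq_le integral_ge0 ?andbT; last by move=> x _; rewrite lee_fin.
  have -> : (\int[mu]_x (D x)%:E = \int[mu]_x (\1_E x * normc (w x) ^+ 2)%:E -
      \int[mu]_x ((M ^+ 2)%:E * (\1_E x)%:E))%E.
    rewrite -integralB//.
      by apply: eq_integral => x _; rewrite -EFinM -EFinB /D mulrBr [M ^+ 2 * _]mulrC.
    apply/integrableP; split.
      apply/measurable_EFinP; apply: measurable_funM => //.
      exact: measurable_funX.
    under eq_integral => x _.
      rewrite gee0_abs; last by rewrite lee_fin mulr_ge0 ?sqr_ge0.
      over.
    apply: le_lt_trans le1 _; rewrite -integralZl//.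
    have /integrableP[_] := iM; apply: le_lt_trans.
    rewrite le_eqVlt; apply/orP; left; apply/eqP; apply: eq_integral => x _.
    by rewrite gee0_abs// mule_ge0// lee_fin ?sqr_ge0.
  rewrite integralZl// sube_le0.
  exact: le1.
have : ae_eq mu setT (fun x => (D x)%:E) (cst 0%E).
  apply/ae_eq_integral_abs => //; first exact/measurable_EFinP.
  by under eq_integral do rewrite gee0_abs ?lee_fin//.
apply: filterS => x /(_ I) [Dx0]; rewrite leNgt; apply/negP => Mx.
have xE : x \in E by rewrite inE.
move: Dx0; rewrite /D indicE xE mul1r => /eqP; rewrite subr_eq0 => /eqP e.
by move: Mx; rewrite -(@ltr_pXn2r _ 2)// ?nnegrE ?normc_ge0// e ltxx.
Qed.

End SymbolBounded.

(** * The Brown-Halmos characterization *)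
Section BrownHalmos.
Context {R : realType} {n : nat}.
Local Notation mu := (torus_measure R n).
Local Notation H2 := (H2 R n).
Implicit Types (F G u : L2 mu) (f g h : H2) (k l p q : 'I_n -> int) (i j : 'I_n).

(** Multiplying both arguments by a character leaves the form of a multiplication
    operator unchanged, and the projection is invisible against the Hardy space. *)
Lemma toeplitz_shift (S : {linear H2 -> H2}) i m f g : toeplitz S ->
  L2dot (S (iter m (Tz i) f)) (iter m (Tz i) g) = L2dot (S f) g.
Proof.
move=> [_ [phi Sphi]]; rewrite !Sphi !hardy_proj_dot !iter_Tz_val.
set k := (fun j => _).
rewrite -(chi_mul_dot k (L2mul phi f)); congr L2dot.
rewrite /chi_mul -[H2_val f]L2class_repr !L2mul_class.
congr L2class; apply: val_inj; apply/funext => x; exact: mulrCA.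
Qed.

(** Both sides of the identity to prove have the same Fourier coefficients at
    nonnegative frequencies: this is clear for monomials, and holds in general by
    density. *)
Theorem brown_halmos (A : {linear H2 -> H2}) : bounded_op A ->
  (forall i f g, L2dot (A (Tz i f)) (Tz i g) = L2dot (A f) g) -> toeplitz A.
Proof.
move=> bA A_shift; split => //.
have [M M0 AM] := (bounded_opP A).1 bA.
have [Phi PhiE] := symbol_exists A_shift M0 AM.
have Phi_bound := symbol_sesquilinear_bound A_shift AM PhiE.
have PhiM := symbol_ae_bounded M0 Phi_bound.
pose w : L2fun mu := repr Phi.
have wL : (w : _ -> _) \in cLfun mu +oo%E.
  by apply: bounded_Linfty PhiM; exact: L2fun_cmeasurable.
exists (MkLinfty wL) => f; apply/esym/hardy_projE => g.
suff key l : nonneg_index l ->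
    fourier_coef (L2mul (MkLinfty wL) f) l = fourier_coef (A f) l.
  apply/eqP; rewrite -subr_eq0 -L2dotBl; apply/eqP; apply: hardy_dot_eq0 => l l0.
  by rewrite /fourier_coef L2dotBl [X in X - _](key l l0) subrr.
move=> l0; pose W := L2mul (Linfty_conj (MkLinfty wL)) (chi l).
have -> : fourier_coef (L2mul (MkLinfty wL) f) l = L2dot f W.
  by rewrite /fourier_coef L2mul_dot.
move: f; apply: hardy_linear_closed_ind => [k k0||c f1 f2 h1 h2|f hf].
- rewrite [RHS](_ : _ = L2dot (A (hardy_chi k)) (hardy_chi l)); last first.
    by rewrite (hardy_chiE l0).
  rewrite (symbol_coefE A_shift k0 l0) -(dot_shift_symbol PhiE).
  rewrite (hardy_chiE k0) -L2mul_dot.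
  rewrite -[in RHS](L2class_repr Phi) /chi_mul /chi !L2mul_class.
  congr (L2dot (L2class _) _); apply: val_inj; apply/funext => x /=; exact: mulrC.
- by rewrite linear0 [LHS]L2dot0l [RHS]L2dot0l.
- rewrite linearP /fourier_coef !H2_valD !H2_valZ !L2dotDl !L2dotZl.
  by rewrite h1 h2.
- apply/eqP; rewrite -subr_eq0 -normc_eq0 eq_le normc_ge0 andbT.
  apply/ler_addgt0Pl => eps eps0; rewrite addr0.
  have p0 : 0 < L2norm W + M + 1 by rewrite ltr_pwDr ?addr_ge0 ?L2norm_ge0.
  have [f' f'W ff'] := hf _ (divr_gt0 eps0 p0).
  have -> : L2dot f W - fourier_coef (A f) l =
      L2dot (f - f') W - L2dot (A (f - f')) (chi l).
    rewrite linearB !H2_valB !L2dotBl f'W /fourier_coef.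
    by rewrite opprB addrA subrK.
  rewrite (le_trans (le_normcD _ _))// normcN.
  apply: le_trans (lerD (L2cauchy_schwarz _ _) (L2cauchy_schwarz _ _)) _.
  rewrite -(hardy_chiE l0) norm_hardy_chi// mulr1.
  apply: le_trans (lerD (lexx _) (AM _)) _.
  rewrite mulrC -mulrDl.
  apply: le_trans (ler_wpM2l _ ff') _; first by rewrite addr_ge0 ?L2norm_ge0.
  by rewrite mulrCA ler_piMr ?(ltW eps0)// ler_pdivrMr// mul1r lerDl.
Qed.

End BrownHalmos.

(** * Relative compactness in the Hardy space *)
Section Nets.
Context {R : realType}.

Lemma quarter_lt (e : R) : 0 < e -> 0 < e / 4 /\ e / 4 + e / 4 < e.
Proof. by move=> e0; split; lra. Qed.

Lemma real_net (B delta : R) : 0 < delta -> exists r : seq R,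
  forall a, `|a| <= B -> exists2 z, z \in r & `|a - z| <= delta.
Proof.
move=> d0.
(* [[-B, B]] is divided from its left end into [K] steps of length [delta]. *)
pose K := (Num.truncn ((B + B) / delta)).+1.
exists [seq i%:R * delta - B | i <- iota 0 K] => a aB.
have /andP[Ba aB'] : - B <= a <= B by rewrite -ler_norml.
pose i := Num.truncn ((a + B) / delta).
have q0 : 0 <= (a + B) / delta by rewrite divr_ge0 ?(ltW d0)//; lra.
have /andP[i1 i2] := truncn_itv q0.
exists (i%:R * delta - B).
  apply/mapP; exists i => //; rewrite mem_iota /= add0n ltnS.
  by apply: le_truncn; rewrite ler_pM2r ?invr_gt0//; lra.
have {}i1 : i%:R * delta <= a + B by rewrite -ler_pdivlMr.
have {}i2 : a + B < i.+1%:R * delta by rewrite -ltr_pdivrMr.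
rewrite -natr1 mulrDl mul1r in i2.
by rewrite ler_norml; apply/andP; split; lra.
Qed.

Lemma complex_net (B delta : R) : 0 < delta -> exists r : seq R[i],
  forall c, normc c <= B -> exists2 z, z \in r & normc (c - z) <= delta.
Proof.
move=> d0; have d2 : 0 < delta / 2 by lra.
have [r rP] := real_net B d2.
exists [seq x +i* y | x <- r, y <- r] => -[a b] abB.
have [x xr ax] := rP a (le_trans (ler_Re_normc (a +i* b)) abB).
have [y yr by_] := rP b (le_trans (ler_Im_normc (a +i* b)) abB).
exists (x +i* y); first by apply/allpairsP; exists (x, y).
have -> : a +i* b - (x +i* y) = (a - x)%:C + 'i%C * (b - y)%:C.
  by rewrite [LHS]complexE.
rewrite (le_trans (le_normcD _ _))// normcM !normc_real.
have -> : normc ('i%C : R[i]) = 1 by rewrite /= expr0n expr1n add0r sqrtr1.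
by rewrite mul1r; lra.
Qed.

End Nets.

Section HardyCompactness.
Context {R : realType} {n : nat}.
Local Notation mu := (torus_measure R n).
Local Notation H2 := (H2 R n).
Implicit Types (f g h : H2).

Definition finite_net (E : set H2) (eps : R) := exists s : seq H2,
  forall f, E f -> exists2 g, g \in s & L2norm (f - g) <= eps.

(** Combinations of finitely many vectors with bounded coefficients: the
    coefficients are rounded to a finite net of the disc. *)
Lemma finite_net_comb (J : finType) (v : J -> H2) (B eps : R) : 0 < eps ->
  finite_net [set f | exists2 c : J -> R[i], forall j, normc (c j) <= B &
    f = \sum_j c j *: v j] eps.
Proof.
move=> eps0; pose V := \sum_j L2norm (v j) + 1.
have V0 : 0 < V by rewrite ltr_pwDr ?sumr_ge0// => j _; exact: L2norm_ge0.
have [r rP] := complex_net B (divr_gt0 eps0 V0).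
pose y (a : {ffun J -> 'I_(size r)}) : H2 := \sum_j nth 0 r (a j) *: v j.
exists [seq y a | a <- enum {ffun J -> 'I_(size r)}] => _ [c cB ->].
have /choice[z zP] : forall j, exists i : 'I_(size r),
    normc (c j - nth 0 r i) <= eps / V.
  move=> j; have [w wr cw] := rP _ (cB j).
  have wi : (index w r < size r)%N by rewrite index_mem.
  by exists (Ordinal wi); rewrite /= nth_index.
exists (y (finfun z)); first by rewrite map_f// mem_enum.
have -> : \sum_j c j *: v j - y (finfun z) =
    \sum_j (c j - nth 0 r (z j)) *: v j.
  rewrite -sumrB; apply: eq_bigr => j _; by rewrite ffunE scalerBl.
rewrite H2_val_sum (le_trans (L2norm_sum _ _ _))//.
apply: (@le_trans _ _ (\sum_j eps / V * L2norm (v j))).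
  by apply: ler_sum => j _; rewrite H2_valZ L2normZ ler_wpM2r ?L2norm_ge0.
by rewrite -mulr_sumr mulrAC ler_pdivrMr// ler_wpM2l ?(ltW eps0)// lerDl.
Qed.

Lemma H2_ballE f g (eps : R) : ball f eps%:C g = (L2norm (f - g) < eps).
Proof. by rewrite -ball_normE /ball_ /= H2_normE ltcR. Qed.

Lemma nbhs_H2 f (V : set H2) : nbhs f V ->
  exists2 eps : R, 0 < eps & forall g, L2norm (f - g) < eps -> V g.
Proof.
move=> /nbhs_ballP[e /= e0 eV].
have eE : e = (complex.Re e)%:C by rewrite RRe_real// gtr0_real.
exists (complex.Re e); first by rewrite -ltcR -eE.
by move=> g fg; apply: eV; rewrite eE H2_ballE.
Qed.

Lemma H2_complete (x : nat -> H2) :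
  (forall e, 0 < e -> exists N, forall m k, (N <= m)%N -> (N <= k)%N ->
    L2norm (x m - x k) <= e) ->
  exists g : H2, forall e, 0 < e -> exists N, forall m, (N <= m)%N ->
    L2norm (g - x m) <= e.
Proof.
move=> cx; have [G HG] := @L2_complete _ _ _ mu (fun m => H2_val (x m)) cx.
suff Gh : G \in @hardy R n by exists (MkH2 Gh).
apply: hardy_of_coef => k k0; apply: (L2dot_cvg HG).
by exists 0 => m _; exact: hardy_coef.
Qed.

(** An ultrafilter that contains a finite union contains one of its members. *)
Lemma ultra_finite_net (U : set_system H2) (E : set H2) (eps : R) :
  UltraFilter U -> U E -> finite_net E eps ->
  exists g, U [set f | L2norm (f - g) <= eps].
Proof.
move=> UU UE [s sP]; apply: contrapT => /forallNP nU.
have : U (E `&` [set f | forall g, g \in s -> ~ L2norm (f - g) <= eps]).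
  elim: s {sP} => [|g s ih]; first by apply: filterS UE => f Ef; split.
  have [/nU//|Ug] := in_ultra_setVsetC [set f | L2norm (f - g) <= eps] UU.
  apply: filterS2 ih Ug => f [Ef fs] fg; split => // h.
  by rewrite in_cons => /orP[/eqP ->|/fs].
move=> /filter_ex[f [Ef fs]]; have [g gs fg] := sP f Ef.
exact: (fs g gs).
Qed.

Lemma finite_net_closure (E : set H2) (eps : R) : 0 < eps ->
  finite_net E (eps / 2) -> finite_net (closure E) eps.
Proof.
move=> eps0 [s sP]; exists s => f fE.
have e2 : 0 < eps / 2 by rewrite divr_gt0.
have /fE[h [Eh fh]] : nbhs f (ball f (eps / 2)%:C).
  by apply: nbhsx_ballx; rewrite ltcR.
have [g gs hg] := sP h Eh; exists g => //.
rewrite H2_ballE in fh.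
rewrite (le_trans (L2norm_triangle _ h _))// [leRHS]splitr.
by apply: lerD hg; exact: ltW fh.
Qed.

(** An ultrafilter on the closure contains small balls of every radius; their
    centres form a Cauchy sequence, whose limit is the limit of the ultrafilter. *)
Lemma compact_closure_finite_net (E : set H2) :
  (forall eps, 0 < eps -> finite_net E eps) -> compact (closure E).
Proof.
move=> Enet; rewrite compact_ultra => U UU UE.
have e0 k : 0 < k.+1%:R^-1 :> R by rewrite invr_gt0.
have /choice[x xP] : forall k : nat, exists g,
    U [set f | L2norm (f - g) <= k.+1%:R^-1].
  move=> k; apply: (ultra_finite_net _ UE); apply: finite_net_closure => //.
  by apply: Enet; rewrite divr_gt0.
have small (e : R) : 0 < e -> exists N, forall k, (N <= k)%N -> k.+1%:R^-1 <= e.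
  move=> ep; have [N _ hN] := near_infty_natSinv_lt (PosNum ep).
  by exists N => k Nk; exact/ltW/hN.
have [e ep|g gP] := @H2_complete x.
  have e2 : 0 < e / 2 by rewrite divr_gt0.
  have [N hN] := small _ e2.
  exists N => m k Nm Nk.
  have /filter_ex[f [/= fm fk]] : U ([set f | L2norm (f - x m) <= m.+1%:R^-1]
      `&` [set f | L2norm (f - x k) <= k.+1%:R^-1]) by exact: filterI.
  rewrite (le_trans (L2norm_triangle _ f _))// L2norm_distC.
  apply: le_trans (lerD fm fk) _.
  by apply: le_trans (lerD (hN m Nm) (hN k Nk)) _; rewrite -splitr.
have Ug : U --> g.
  move=> V /nbhs_H2[e ep eV].
  have [e4 e42] := quarter_lt ep.
  have [N1 hN1] := gP _ e4; have [N2 hN2] := small _ e4.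
  apply: filterS (xP (maxn N1 N2)) => f /= fx; apply: eV.
  rewrite (le_lt_trans (L2norm_triangle _ (x (maxn N1 N2)) _))//.
  rewrite [X in _ + X]L2norm_distC.
  apply: le_lt_trans (lerD (hN1 _ (leq_maxl N1 N2)) fx) _.
  by apply: le_lt_trans (lerD (lexx _) (hN2 _ (leq_maxr N1 N2))) _.
exists g; split => //.
apply: (@closed_cvg _ _ U _ id (closure E)) => //; exact: closed_closure.
Qed.

Lemma compact_closure_net (E : set H2) (eps : R) : 0 < eps ->
  compact (closure E) -> finite_net E eps.
Proof.
move=> eps0; rewrite compact_cover => /(_ H2 setT (fun g => ball g eps%:C)).
case.
- by move=> g _; exact: ball_open.
- by move=> g _; exists g => //; apply: ballxx; rewrite ltcR.
- move=> D _ ED; exists (finmap.enum_fset D) => f /subset_closure /ED[g /= gD].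
  by rewrite H2_ballE L2norm_distC => /ltW fg; exists g.
Qed.

End HardyCompactness.

(** * Cutting frequencies by a box *)
Section BoxDecomposition.
Context {R : realType} {n : nat}.
Local Notation mu := (torus_measure R n).
Local Notation H2 := (H2 R n).
Implicit Types (f g h : H2) (k l p q : 'I_n -> int) (i j : 'I_n).
Variable m : nat.

Definition in_box k := nonneg_index k && [forall j, k j < m%:Z].

Definition box_index (a : {ffun 'I_n -> 'I_m}) : 'I_n -> int := fun j => Posz (a j).

(** The projection onto the polynomials of degree less than [m] in each variable. *)
Definition box_part f : H2 :=
  \sum_a fourier_coef f (box_index a) *: hardy_chi (box_index a).

Lemma box_index_nonneg a : nonneg_index (box_index a).
Proof. by apply/forallP. Qed.

Lemma fourier_sum (I : Type) (r : seq I) (P : pred I) (F : I -> L2 mu) k :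
  fourier_coef (\sum_(i <- r | P i) F i) k = \sum_(i <- r | P i) fourier_coef (F i) k.
Proof. exact: L2dot_suml. Qed.

Lemma fourier_box_part f k :
  fourier_coef (box_part f) k = if in_box k then fourier_coef f k else 0.
Proof.
rewrite /box_part H2_val_sum fourier_sum.
have chiE a : fourier_coef (fourier_coef f (box_index a) *: hardy_chi (box_index a)) k =
    fourier_coef f (box_index a) * L2dot (chi (box_index a)) (chi k).
  by rewrite /fourier_coef H2_valZ L2dotZl (hardy_chiE (box_index_nonneg a)).
under eq_bigr do rewrite chiE.
have neq a : (exists j, box_index a j != k j) ->
    fourier_coef f (box_index a) * L2dot (chi (box_index a)) (chi k) = 0.
  by move=> ak; rewrite dot_chi_neq// mulr0.
case: ifPn => [/andP[/forallP k0 /forallP km]|kbox].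
- have kmn j : (`|k j| < m)%N by have := k0 j; have := km j; lia.
  pose a : {ffun 'I_n -> 'I_m} := [ffun j => Ordinal (kmn j)].
  have ak : box_index a = k.
    by apply/funext => j; rewrite /box_index ffunE /= gez0_abs.
  rewrite (bigD1 a)//= ak dot_chi_eq mulr1 big1 ?addr0// => b ba.
  apply: neq; apply: contrapT => /forallNP h; move/eqP: ba; apply.
  apply/ffunP => j; apply: val_inj; rewrite ffunE /=.
  by have /negP/negPn/eqP <- := h j.
- rewrite big1// => a _; apply: neq; apply: contrapT => /forallNP h.
  move/negP: kbox; apply; have <- : box_index a = k.
    by apply/funext => j; apply/eqP/negPn/negP; exact: h.
  by rewrite /in_box box_index_nonneg; apply/forallP => j; rewrite ltz_nat.
Qed.

Definition off_box f : H2 := f - box_part f.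

Lemma fourier_off_box f k :
  fourier_coef (off_box f) k = if in_box k then 0 else fourier_coef f k.
Proof.
rewrite /fourier_coef /off_box H2_valB L2dotBl.
have := fourier_box_part f k; rewrite /fourier_coef => ->.
by case: ifP => _; rewrite ?subrr ?subr0.
Qed.

Lemma dot_box_off f g : L2dot (box_part f) (off_box g) = 0.
Proof.
apply: dot_eq0_fourier => k; rewrite fourier_box_part fourier_off_box.
by case: ifP => _; [right|left].
Qed.

Lemma box_split f : f = box_part f + off_box f.
Proof. by rewrite addrC subrK. Qed.

Lemma off_box_norm f : L2norm (off_box f) <= L2norm f.
Proof.
rewrite -(@ler_pXn2r _ 2)// ?nnegrE ?L2norm_ge0//.
have := L2pythagoras (dot_box_off f f); rewrite -H2_valD -box_split => ->.
by rewrite lerDr sqr_ge0.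
Qed.

Lemma hardy_fourier_ext f g : (forall k, nonneg_index k ->
  fourier_coef f k = fourier_coef g k) -> f = g.
Proof.
move=> fg; apply: H2_inj; apply: fourier_ext => k.
by case: (boolP (nonneg_index k)) => [/fg//|k0]; rewrite !hardy_coef.
Qed.

Lemma fourier_linear (c : R[i]) f g k : fourier_coef (c *: f + g) k =
  c * fourier_coef f k + fourier_coef g k.
Proof. by rewrite /fourier_coef H2_valD H2_valZ L2dotDl L2dotZl. Qed.

Lemma off_box_linear (c : R[i]) f g :
  off_box (c *: f + g) = c *: off_box f + off_box g.
Proof.
apply: hardy_fourier_ext => k _; rewrite fourier_off_box.
rewrite [RHS]fourier_linear !fourier_off_box fourier_linear.
by case: ifP => _; rewrite ?mulr0 ?addr0.
Qed.

(** Sorting the frequencies outside the box by the first coordinate that leaves it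
    splits them into [n] disjoint classes. *)
Definition first_exit i k :=
  [&& nonneg_index k, m%:Z <= k i & [forall j : 'I_n, (j < i)%N ==> (k j < m%:Z)]].

Lemma first_exit_unique k : nonneg_index k -> ~~ in_box k ->
  exists2 i, first_exit i k & forall j, first_exit j k -> j = i.
Proof.
move=> k0; rewrite /in_box k0 /= negb_forall => /existsP[j0]; rewrite -leNgt => mj0.
pose P := [pred j : 'I_n | m%:Z <= k j].
have [i Pi imin] := @arg_minnP _ j0 P (@nat_of_ord n) mj0.
have Ei : first_exit i k.
  apply/and3P; split=> //; apply/forallP => j; apply/implyP => ji.
  by rewrite ltNge; apply/negP => mj; have := imin j mj; rewrite leqNgt ji.
exists i => // j /and3P[_ mj /forallP hj].
apply/val_inj/eqP; rewrite eqn_leq imin// andbT leqNgt; apply/negP => ij.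
by have := hj i; rewrite ij /= ltNge; move: Pi => /= ->.
Qed.

(** Each piece has frequencies with [i]-th coordinate at least [m], so that
    [z_i ^ m] factors out of it within the Hardy space. *)
Lemma off_box_decomposition f : (forall k, in_box k -> fourier_coef f k = 0) ->
  exists2 s : 'I_n -> H2, forall i, L2norm (s i) <= L2norm f &
    f = \sum_i iter m (Tz i) (s i).
Proof.
move=> f0.
have /choice[s sP] : forall i, exists h : H2, L2norm h <= L2norm f /\
    forall k, fourier_coef (iter m (Tz i) h) k =
      if first_exit i k then fourier_coef f k else 0.
  move=> i; have [G Gf Gk] := hardy_restrict (H2_val f) (first_exit i).
  have E k : fourier_coef G k = if first_exit i k then fourier_coef f k else 0.
    rewrite Gk; case: (boolP (first_exit i k)) => [|]; last by rewrite andbF.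
    by case/and3P => ->.
  (* [e] is the exponent of [z_i ^ m]. *)
  pose e : 'I_n -> int := fun j => unit_index i j *+ m.
  have ek j : e j = if j == i then m%:Z else 0.
    by rewrite /e /unit_index; case: eqP => _; rewrite ?mul0rn//= natz.
  have Hh : chi_mul (fun j => - e j) G \in @hardy R n.
    apply: hardy_of_coef => k k0; rewrite fourier_chi_mul E; case: ifP => // ex.
    move/negP: k0; case; move/and3P: ex => [/forallP n0 + _].
    move=> mi; apply/forallP => j; have := n0 j; move: mi; rewrite !ek eqxx opprK.
    by case: eqP => [->|_]; lia.
  exists (MkH2 Hh); split; first by rewrite /= chi_mul_norm.
  by move=> k; rewrite iter_Tz_val /= -E; congr fourier_coef; exact: chi_mulNK.
exists s; first by move=> i; case: (sP i).
apply: hardy_fourier_ext => k k0; rewrite H2_val_sum fourier_sum.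
under eq_bigr => i _ do rewrite (sP i).2.
case: (boolP (in_box k)) => kb.
  by rewrite (f0 k kb) big1// => i _; case: ifP.
have [i ei iuniq] := first_exit_unique k0 kb.
rewrite (bigD1 i)//= ei big1 ?addr0// => j ji.
by case: ifP => // /iuniq ij; rewrite ij eqxx in ji.
Qed.

(** Expanding both arguments by [off_box_decomposition], the [n * n] terms are
    entries of the operators [Tz_adj i m \o K \o iter m (Tz j)]. *)
Lemma off_box_dot_bound (K : {linear H2 -> H2}) (delta : R) f g : 0 <= delta ->
  (forall i j f, L2norm (Tz_adj i m (K (iter m (Tz j) f))) <= delta * L2norm f) ->
  normc (L2dot (K (off_box f)) (off_box g)) <=
    (n * n)%:R * delta * L2norm f * L2norm g.
Proof.
move=> d0 Kd.
have offP h : forall k, in_box k -> fourier_coef (off_box h) k = 0.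
  by move=> k kb; rewrite fourier_off_box kb.
have [s sf fE] := off_box_decomposition (offP f).
have [t tg gE] := off_box_decomposition (offP g).
rewrite fE gE linear_sum !H2_val_sum L2dot_suml.
have normc_sum (I : finType) (F : I -> R[i]) :
    normc (\sum_i F i) <= \sum_i normc (F i).
  elim/big_ind2 : _ => [|x a y b xa yb|//]; first by rewrite normc0.
  by rewrite (le_trans (le_normcD _ _))// lerD.
rewrite (le_trans (normc_sum _ _))//.
apply: (@le_trans _ _ (\sum_(j < n) \sum_(i < n) delta * L2norm f * L2norm g)).
  apply: ler_sum => j _; rewrite L2dot_sumr (le_trans (normc_sum _ _))//.
  apply: ler_sum => i _; rewrite [L2dot _ _]L2dotC normc_conj Tz_adj_dot.
  rewrite (le_trans (L2cauchy_schwarz _ _))// mulrC ler_pM ?L2norm_ge0//.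
    by rewrite (le_trans (Kd _ _ _))// ler_wpM2l// (le_trans (sf j))// off_box_norm.
  by rewrite (le_trans (tg i))// off_box_norm.
by rewrite !sumr_const !card_ord -mulrnA -!mulrA mulr_natl.
Qed.

End BoxDecomposition.

(** * Limits along the shifts *)
Section AsymptoticToeplitz.
Context {R : realType} {n : nat}.
Local Notation mu := (torus_measure R n).
Local Notation H2 := (H2 R n).
Implicit Types (f g h : H2) (k l p q : 'I_n -> int) (i j : 'I_n).

Lemma normc_fourier_coef_le f k : nonneg_index k ->
  normc (fourier_coef f k) <= L2norm f.
Proof.
move=> k0; rewrite /fourier_coef -/(chi k) -(hardy_chiE k0).
by rewrite (le_trans (L2cauchy_schwarz _ _))// norm_hardy_chi// mulr1.
Qed.

Lemma off_box_idem m f : off_box m (off_box m f) = off_box m f.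
Proof.
apply: hardy_fourier_ext => k _; rewrite !fourier_off_box.
by case: (in_box m k).
Qed.

Lemma dot_off_box m f g :
  L2dot (off_box m f) (off_box m g) = L2dot f (off_box m g).
Proof.
transitivity (L2dot (H2_val (box_part m f) + H2_val (off_box m f)) (off_box m g)).
  by rewrite L2dotDl dot_box_off add0r.
by rewrite -H2_valD -box_split.
Qed.

Lemma off_box_sum m (K : {linear H2 -> H2}) (I : finType) (c : I -> R[i]) (v : I -> H2) :
  off_box m (K (\sum_i c i *: v i)) = \sum_i c i *: off_box m (K (v i)).
Proof.
have off0 : off_box m (0 : H2) = 0.
  have := @off_box_linear R n m (-1) 0 0.
  by rewrite !scaleN1r !addNr.
rewrite linear_sum; elim/big_ind2 : _ => [//|x a y b xa yb|i _].
  by rewrite -[a]scale1r off_box_linear xa yb scale1r.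
by rewrite linearZ -[X in off_box m X = _]addr0 off_box_linear off0 addr0.
Qed.

(** Up to an error [w] bounded by [off_box_dot_bound], the image of [f] is a
    combination of finitely many fixed vectors, namely the monomials in the box
    and the parts off the box of their images, with bounded coefficients. *)
Lemma compact_op_off_box (K : {linear H2 -> H2}) : bounded_op K ->
  (forall eps : R, 0 < eps -> exists m, forall i j f,
    L2norm (Tz_adj i m (K (iter m (Tz j) f))) <= eps * L2norm f) ->
  compact_op K.
Proof.
move=> bK Km; have [M M0 KM] := (bounded_opP K).1 bK.
apply: compact_closure_finite_net => eps eps0.
have e2 : 0 < eps / 2 by rewrite divr_gt0.
have nn0 : 0 < (n * n)%:R + 1 :> R by rewrite ltr_pwDr.
have [m mP] := Km _ (divr_gt0 e2 nn0).
(* There are [n * n] terms in [off_box_dot_bound]; [1] keeps the divisor positive. *)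
set delta := eps / 2 / _ in mP.
have d0 : 0 <= delta by rewrite ltW// divr_gt0.
pose J := {ffun 'I_n -> 'I_m}.
pose v (a : J + J) : H2 := match a with
  | inl a => hardy_chi (box_index a)
  | inr a => off_box m (K (hardy_chi (box_index a))) end.
have [s sP] := finite_net_comb v (M + 1) e2.
exists s => _ [f /= f1 <-]; rewrite le1_H2_norm in f1.
pose w := off_box m (K (off_box m f)).
have [g gs gP] : exists2 g, g \in s & L2norm (K f - w - g) <= eps / 2.
  apply: sP; exists (fun a : J + J => match a with
    | inl a => fourier_coef (K f) (box_index a)
    | inr a => fourier_coef f (box_index a) end).
    move=> [a|a]; apply: le_trans (normc_fourier_coef_le _ (box_index_nonneg a)) _.
      apply: le_trans (KM f) _; apply: (@le_trans _ _ M); last by rewrite lerDl.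
      by rewrite ler_piMr.
    by rewrite (le_trans f1)// lerDr.
  rewrite big_sumType /= -off_box_sum -/(box_part m (K f)) -/(box_part m f).
  rewrite [in LHS](box_split m (K f)) -addrA; congr (_ + _).
  rewrite {1}(box_split m f) linearD -[K (box_part m f)]scale1r off_box_linear.
  by rewrite !scale1r addrK.
exists g => //; have -> : H2_val (K f) - H2_val g =
    H2_val w + (H2_val (K f) - H2_val w - H2_val g).
  by rewrite addrA [H2_val w + _]addrC subrK.
rewrite (le_trans (ler_L2normD _ _))//.
have wle : L2norm w <= eps / 2.
  apply: L2norm_le_dot; first exact: ltW.
  have -> : L2dot w w = L2dot (K (off_box m f)) (off_box m w).
    by rewrite /w off_box_idem dot_off_box.
  apply: le_trans (off_box_dot_bound _ _ d0 mP) _.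
  rewrite ler_wpM2r ?L2norm_ge0//.
  apply: (@le_trans _ _ ((n * n)%:R * delta)).
    by rewrite ler_piMr// mulr_ge0.
  by rewrite /delta mulrCA ler_piMr ?(ltW e2)// ler_pdivrMr// mul1r lerDl.
by apply: le_trans (lerD wle gP) _; rewrite -splitr.
Qed.

Lemma Tz_adj_hardy_chi i m k : nonneg_index k -> (`|k i| < m)%N ->
  Tz_adj i m (hardy_chi k : H2) = 0.
Proof.
move=> k0 km; apply: hardy_extr => g; rewrite -Tz_adj_dot [RHS]L2dot0r.
rewrite (hardy_chiE k0) -[LHS]/(fourier_coef _ k) fourier_iter_Tz.
apply: hardy_coef; apply/negP => /forallP/(_ i).
rewrite /unit_index eqxx natz; lia.
Qed.

(** The adjoint shift kills a monomial after finitely many steps, and its powers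
    are contractions. *)
Lemma Tz_adj_cvg0 i h eps : 0 < eps -> exists N, forall m, (N <= m)%N ->
  L2norm (Tz_adj i m h) <= eps.
Proof.
move: h eps; apply: hardy_linear_closed_ind =>
  [k k0|eps e0|c f g fP gP eps e0|f fP eps e0].
- move=> eps e0; exists (`|k i|%N).+1 => m km.
  by rewrite Tz_adj_hardy_chi// [L2norm _]L2norm0 ltW.
- by exists 0 => m _; rewrite Tz_adj0 [L2norm _]L2norm0 ltW.
- have c0 : 0 < normc c + 1 by rewrite ltr_pwDr ?normc_ge0.
  have e2 : 0 < eps / 2 by rewrite divr_gt0.
  have [N1 h1] := fP _ (divr_gt0 e2 c0); have [N2 h2] := gP _ e2.
  exists (maxn N1 N2) => m; rewrite geq_max => /andP[/h1 m1 /h2 m2].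
  rewrite Tz_adj_linear H2_valD H2_valZ (le_trans (ler_L2normD _ _))// L2normZ.
  rewrite [leRHS]splitr.
  rewrite lerD//; apply: le_trans (ler_wpM2l (normc_ge0 _) m1) _.
  by rewrite mulrCA ler_piMr ?(ltW e2)// ler_pdivrMr// mul1r lerDl.
- have e2 : 0 < eps / 2 by rewrite divr_gt0.
  have [g gP fg] := fP _ e2; have [N hN] := gP _ e2.
  exists N => m /hN gm; rewrite -[f](subrK g) Tz_adjD H2_valD.
  rewrite (le_trans (ler_L2normD _ _))//.
  rewrite [leRHS]splitr.
  by rewrite lerD// (le_trans (Tz_adj_norm _ _ _)).
Qed.

(** Pointwise convergence to [0] of contractions is uniform on a finite net of the
    image of the unit ball. *)
Lemma compact_Tz_adj_cvg0 (K : {linear H2 -> H2}) i eps : compact_op K -> 0 < eps ->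
  exists N, forall m, (N <= m)%N -> forall f, L2norm f <= 1 ->
    L2norm (Tz_adj i m (K f)) <= eps.
Proof.
move=> cK e0; have e2 : 0 < eps / 2 by rewrite divr_gt0.
have [s sP] := compact_closure_net e2 cK.
have [N hN] : exists N, forall m, (N <= m)%N -> forall g, g \in s ->
    L2norm (Tz_adj i m g) <= eps / 2.
  elim: s {sP} => [|g s [N1 h1]]; first by exists 0.
  have [N2 h2] := Tz_adj_cvg0 i g e2.
  exists (maxn N1 N2) => m; rewrite geq_max => /andP[/h1 m1 /h2 m2] f.
  by rewrite in_cons => /orP[/eqP ->|/m1].
exists N => m Nm f f1.
have [|g gs fg] := sP (K f); first by exists f => //=; rewrite le1_H2_norm.
rewrite -[K f](subrK g) Tz_adjD H2_valD (le_trans (ler_L2normD _ _))//.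
rewrite [leRHS]splitr.
by apply: lerD; [exact: le_trans (Tz_adj_norm _ _ _) fg|exact: hN].
Qed.

Lemma toeplitz_Tz_adj (S : {linear H2 -> H2}) i m f : toeplitz S ->
  Tz_adj i m (S (iter m (Tz i) f)) = S f.
Proof.
move=> tS; apply: hardy_ext => g.
by rewrite [LHS]L2dotC -Tz_adj_dot -L2dotC toeplitz_shift.
Qed.

Lemma iter_TzZ i m (c : R[i]) f : iter m (Tz i) (c *: f) = c *: iter m (Tz i) f.
Proof. by apply: H2_inj; rewrite H2_valZ !iter_Tz_val H2_valZ chi_mulZ. Qed.

Lemma Tz_adjZ i m (c : R[i]) f : Tz_adj i m (c *: f) = c *: Tz_adj i m f.
Proof. by rewrite -[c *: f]addr0 Tz_adj_linear Tz_adj0 addr0. Qed.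

(** Applying the [m]-th operator of the sequence to shifted arguments gives the
    [m.+1]-st one, which has the same limit. *)
Lemma asymptotic_limit_shift (T A : {linear H2 -> H2}) i :
  (fun m => opnorm (fun f =>
     iter m (adjoint (Tz i)) (T (iter m (Tz i) f)) - A f)) @ \oo --> 0%E ->
  forall f g, L2dot (A (Tz i f)) (Tz i g) = L2dot (A f) g.
Proof.
move=> /opnorm_cvg0 TA f g.
have TAf (eps : R) : 0 < eps -> exists N, forall m, (N <= m)%N -> forall h,
    L2norm (Tz_adj i m (T (iter m (Tz i) h)) - A h) <= eps * L2norm h.
  move=> e0; have [N hN] := TA _ e0; exists N => m /hN; apply: unit_ball_bound => //.
    by move=> c h; rewrite iter_TzZ [T _]linearZ [A _]linearZ
      [iter _ _ (_ *: _)]Tz_adjZ scalerBr.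
  exact: ltW.
apply/eqP; rewrite -subr_eq0 -normc_eq0 eq_le normc_ge0 andbT.
apply/ler_addgt0Pl => eps eps0; rewrite addr0.
have L0 : 0 < 2 * (L2norm f * L2norm g) + 1.
  by rewrite ltr_pwDr// !mulr_ge0 ?L2norm_ge0.
have [N hN] := TAf _ (divr_gt0 eps0 L0).
set e := eps / _ in hN.
have near m f' g' : (N <= m)%N -> normc
    (L2dot (T (iter m (Tz i) f')) (iter m (Tz i) g') - L2dot (A f') g') <=
    e * (L2norm f' * L2norm g').
  move=> Nm; rewrite [X in X - _]L2dotC Tz_adj_dot -L2dotC -L2dotBl mulrA.
  apply: le_trans (L2cauchy_schwarz _ _) _.
  by rewrite ler_wpM2r ?L2norm_ge0//; exact: (hN m Nm f').
have h1 := near N.+1 f g (leqnSn N).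
have h2 := near N (Tz i f) (Tz i g) (leqnn N).
rewrite -!iterSr in h2.
have nT h : L2norm (Tz i h) = L2norm h := iter_Tz_norm i 1 h.
rewrite !nT in h2.
move: h1 h2; set X := L2dot (T _) _; set Y := L2dot (A f) g; set Z := L2dot _ _.
move=> h1 h2; rewrite (_ : Z - Y = (X - Y) - (X - Z)); last first.
  by rewrite opprB [RHS]addrC addrA subrK.
rewrite (le_trans (le_normcD _ _))// normcN (le_trans (lerD h1 h2))//.
rewrite -mulr2n -mulr_natl mulrCA /e mulrAC ler_pdivrMr//.
by rewrite ler_wpM2l ?(ltW eps0)// lerDl.
Qed.

End AsymptoticToeplitz.

(** * The equivalence *)
Section Equivalence.
Context {R : realType} {n : nat}.
Local Notation H2 := (H2 R n).
Implicit Types (f g h : H2) (i j : 'I_n).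

(** The Toeplitz part is the limit [A], and the second family of limits makes the
    remainder compact. *)
Lemma asymptotic_toeplitz_decomposition (T : {linear H2 -> H2}) :
  asymptotic_toeplitz T -> exists S K : {linear H2 -> H2},
    [/\ toeplitz S, compact_op K & forall f, T f = S f + K f].
Proof.
move=> [bT [A bA TA]].
have tA : toeplitz A.
  by apply: brown_halmos => // i; apply: asymptotic_limit_shift (TA i i).1.
pose K : {linear H2 -> H2} := T \- A.
have KE f : K f = T f - A f by [].
exists A, K; split=> //; last by move=> f; rewrite KE addrC subrK.
apply: compact_op_off_box.
  have [M1 M10 h1] := (bounded_opP T).1 bT.
  have [M2 M20 h2] := (bounded_opP A).1 bA.
  apply/bounded_opP; exists (M1 + M2); first exact: addr_ge0.
  by move=> f; rewrite KE H2_valB (le_trans (ler_L2normB _ _))// mulrDl lerD.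
move=> eps e0.
have /choice[N NP] : forall ij : 'I_n * 'I_n, exists N, forall m, (N <= m)%N ->
    forall f, L2norm (Tz_adj ij.1 m (K (iter m (Tz ij.2) f))) <= eps * L2norm f.
  move=> [i j]; have [_ /opnorm_cvg0 /(_ _ e0)[N hN]] := TA i j.
  exists N => m Nm; apply: unit_ball_bound; first last.
  - by move=> f f1; exact: hN.
  - exact: ltW.
  - by move=> c f; rewrite iter_TzZ [K _]linearZ Tz_adjZ.
(* The sum of the thresholds dominates each of them. *)
exists (\sum_ij N ij)%N => i j f; apply: (NP (i, j)).
by rewrite (bigD1 (i, j))//= leq_addr.
Qed.

(** The Toeplitz part is fixed by conjugation with the shifts, and the compact part
    tends to [0] because the shifts are isometries. *)
Lemma toeplitz_plus_compact_asymptotic (T S K : {linear H2 -> H2}) :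
  bounded_op T -> toeplitz S -> compact_op K -> (forall f, T f = S f + K f) ->
  asymptotic_toeplitz T.
Proof.
move=> bT tS cK TE; split=> //; exists S; first by case: tS.
have Kcvg i j (eps : R) : 0 < eps -> exists N, forall m, (N <= m)%N ->
    forall f, L2norm f <= 1 -> L2norm (Tz_adj i m (K (iter m (Tz j) f))) <= eps.
  move=> /(compact_Tz_adj_cvg0 i cK)[N hN]; exists N => m Nm f f1.
  by apply: hN => //; rewrite iter_Tz_norm.
move=> i j; split; apply/opnorm_cvg0 => eps.
- move=> /(Kcvg i i)[N hN]; exists N => m Nm f f1.
  rewrite TE -/(Tz_adj i m _) Tz_adjD (toeplitz_Tz_adj _ _ _ tS) addrAC subrr add0r.
  exact: hN.
- move=> /(Kcvg i j)[N hN]; exists N => m Nm f f1.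
  rewrite TE addrAC subrr add0r; exact: hN.
Qed.

End Equivalence.

Theorem theorem3p4 (R : realType) (n : nat) (n_ge1 : (1 <= n)%N)
    (T : {linear H2 R n -> H2 R n}) (T_bounded : bounded_op T) :
  asymptotic_toeplitz T <->
  exists S K : {linear H2 R n -> H2 R n},
    [/\ toeplitz S, compact_op K & forall f : H2 R n, T f = S f + K f].
Proof.
split=> [|[S [K [tS cK TE]]]]; first exact: asymptotic_toeplitz_decomposition.
exact: toeplitz_plus_compact_asymptotic tS cK TE.
Qed.
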